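(* Let $0<q\leq\infty$ and $\alpha<-1/q$. Then there is a constant $C$ depending only on $q$ and $\alpha$ such that the following holds. Let $\{\varphi_n\}$ be an orthonormal system in $L_2(0,1)$ with $M:=\sup_n\|\varphi_n\|_{L_\infty(0,1)}<\infty$, and let $f$ be a function on $[0,1]$ for which the right-hand side below is finite. Then the Fourier coefficients $c_n(f)$ of $f$ with respect to $\{\varphi_n\}$ satisfy $$\left(\sum_{k=1}^{\infty}\left[(1+|\log k|)^{\alpha}\left(\sum_{i=1}^{k}\left(c_i^*(f)\right)^2\right)^{1/2}\right]^q k^{-1}\right)^{1/q}\leq C\,\min\left(M,(1+\log M)^{|\alpha|}\right)\left(\int_0^1\left[(1+|\log t|)^{\alpha}\left(\int_t^1\left(f^*(u)\right)^2du\right)^{1/2}\right]^q t^{-1}\,dt\right)^{1/q}.$$ When $q=\infty$, the outer sum and outer integral are replaced by suprema, that is, by $\sup_{k\ge1}(1+|\log k|)^{\alpha}\left(\sum_{i=1}^k (c_i^*(f))^2\right)^{1/2}$ and $\sup_{0<t<1}(1+|\log t|)^{\alpha}\left(\int_t^1 (f^*(u))^2du\right)^{1/2}$ respectively.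
   Context: Functions are (equivalence classes of) complex-valued measurable functions on $[0,1]$ with Lebesgue measure. The system $\{\varphi_n\}$ is indexed by $n\in\mathbb{N}$ or $n\in\mathbb{Z}$. The Fourier coefficients are $c_n(f)=\int_0^1 f(x)\overline{\varphi_n(x)}\,dx$. $f^*$ is the non-increasing rearrangement of $|f|$, and $\{c_k^*(f)\}_{k\in\mathbb{N}}$ is the non-increasing rearrangement of the sequence $\{|c_n(f)|\}$. Orthonormality implies $M\geq 1$. The convention $1/\infty=0$ is used. *)

(* Defs.v *)
From HB Require Import structures.
From mathcomp Require Import all_boot all_order all_algebra.
From mathcomp Require Import all_classical all_reals all_analysis.
From mathcomp Require Import complex.

Set Implicit Arguments.
Unset Strict Implicit.
Unset Printing Implicit Defensive.

Import Order.TTheory GRing.Theory Num.Theory.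
Import numFieldNormedType.Exports.

Local Open Scope classical_set_scope.
Local Open Scope complex_scope.
Local Open Scope ring_scope.

Notation cnorm := ComplexField.Normc.normc.

Section complex_functions.
Context {R : realType}.

(* A function on [0,1] is a function on R, only the values on [0,1] being used. *)
Definition unit_itv : set R := `[0, 1].

Definition cmeasurable (f : R -> R[i]) : Prop :=
  measurable_fun unit_itv (fun x => complex.Re (f x)) /\
  measurable_fun unit_itv (fun x => complex.Im (f x)).

Definition cintegral (f : R -> R[i]) : R[i] :=
  (\int[lebesgue_measure]_(x in unit_itv) complex.Re (f x)) +i*
  (\int[lebesgue_measure]_(x in unit_itv) complex.Im (f x)).

Definition in_L2 (f : R -> R[i]) : Prop :=
  cmeasurable f /\
  (\int[lebesgue_measure]_(x in unit_itv) ((cnorm (f x)) ^+ 2)%:E < +oo)%E.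

Definition inner_L2 (f g : R -> R[i]) : R[i] :=
  cintegral (fun x => f x * (g x)^*).

Definition unit_measure : {measure set (measurableTypeR R) -> \bar R} :=
  mrestr lebesgue_measure (measurable_itv `[0%R, 1%R]).

Definition Loo_norm (f : R -> R[i]) : \bar R :=
  'N[unit_measure]_+oo[EFin \o (fun x => cnorm (f x))]%E.

Definition fun_rearrangement (f : R -> R[i]) (t : R) : \bar R :=
  ereal_inf (EFin @` [set s : R | 0 <= s /\
    (lebesgue_measure [set x | unit_itv x /\ (s < cnorm (f x))%R] <= t%:E)%E]).

End complex_functions.

Variant index_kind := Naturals | Integers.

Definition sys_index (k : index_kind) : countType :=
  match k with Naturals => nat | Integers => int end.

Section systems.
Context {R : realType} {k : index_kind}.
Implicit Types (phi : sys_index k -> R -> R[i]) (f : R -> R[i]) (c : sys_index k -> R[i]).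

Definition orthonormal_system phi : Prop :=
  (forall n, in_L2 (phi n)) /\
  (forall m n, inner_L2 (phi m) (phi n) = (m == n)%:R).

Definition sup_norm phi : \bar R := ereal_sup (range (fun n => Loo_norm (phi n))).

Definition fourier_coef phi f (n : sys_index k) : R[i] :=
  cintegral (fun x => f x * (phi n x)^*).

(* The i-th largest modulus, for i >= 1: the least s >= 0 that fewer than i of
   the |c n| exceed. *)
Definition seq_rearrangement c (i : nat) : \bar R :=
  ereal_inf (EFin @` [set s : R | 0 <= s /\
    ([set n | (s < cnorm (c n))%R] #<= `I_i.-1)%card]).

End systems.

Section quasinorms.
Context {R : realType}.
Local Open Scope ereal_scope.

Definition log_weight (alpha t : R) : R := ((1 + `|ln t|) `^ alpha)%R.

(* In the two definitions below the value at q = -oo is a dummy. *)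
Definition seq_quasinorm (q : \bar R) (alpha : R) (cs : nat -> \bar R) : \bar R :=
  let F (k : nat) := (log_weight alpha k%:R)%:E *
    (\sum_(1 <= i < k.+1) cs i ^+ 2) `^ 2^-1 in
  match q with
  | r%:E => (\sum_(1 <= k <oo) F k `^ r * (k%:R^-1)%:E) `^ r^-1
  | +oo => ereal_sup [set F k | k in [set k | (1 <= k)%N]]
  | -oo => 0
  end.

Definition fun_quasinorm (q : \bar R) (alpha : R) (fs : R -> \bar R) : \bar R :=
  let F (t : R) := (log_weight alpha t)%:E *
    (\int[lebesgue_measure]_(u in `[t, 1%R]) fs u ^+ 2) `^ 2^-1 in
  match q with
  | r%:E =>
      (\int[lebesgue_measure]_(t in `]0%R, 1%R[) (F t `^ r * (t^-1)%:E)) `^ r^-1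
  | +oo => ereal_sup [set F t | t in `]0%R, 1%R[]
  | -oo => 0
  end.

End quasinorms.

(* Main.v *)
(* Cut f at the level f^*(t), t = 4^-(j+p): f = g + h with g = f where |f| <= f^*(t).
   Bessel's inequality controls the coefficients of g by the L2 norm of g, and those
   of h are at most M times the L1 norm of h, so that the 4^(j+1) largest
   coefficients of f have l2 norm at most
     ||g||_2 + 2^(j+1) M ||h||_1
       <= C max(1, M/2^p) sum_m 2^-m (int_{4^-(j+p+m)}^1 f^*(u)^2 du)^(1/2);
   both norms are estimated by slicing f along the levels f^*(4^-i).
   The geometric weights 2^-m beat the logarithmic ones, so replacing the sum by a
   weighted supremum (or l^q norm) over m yields the inequality for all q at once;
   shifting by p costs (1+p)^|alpha|, and p = 0 or 2^p ~ M gives the two bounds. *)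

Require Import Defs.
From HB Require Import structures.
From mathcomp Require Import all_boot all_order all_algebra.
From mathcomp Require Import all_classical all_reals all_analysis.
From mathcomp Require Import complex measurable_realfun ess_sup_inf.
From mathcomp Require Import ring lra zify.

Set Implicit Arguments.
Unset Strict Implicit.
Unset Printing Implicit Defensive.

Import Order.TTheory GRing.Theory Num.Theory.
Import numFieldNormedType.Exports.

Local Open Scope classical_set_scope.
Local Open Scope complex_scope.
Local Open Scope ring_scope.

(** The constants share out one budget. Passing from 4^-i to 4^-(i+1) halves square roots of
    measures, and the L1 norm of the large part stays summable as long as the square roots of the
    tail energies grow by a factor below 2 per level. The rate allowed is 3/2 = (5/4)(6/5): the
    powers of 5/4 absorb the logarithmic weight (1+m)^|alpha|, those of 6/5 pay for replacing all
    tails beyond a block by one majorant, and the ratio 3/4 that remains is summed as a geometric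
    series.

    The function f is not assumed integrable: finiteness of f^*(4^-j), and integrability of the
    large part against the system, are extracted from the bounds on the tail energies. Of f^* there
    enter its sign and monotonicity, f^*(1) = 0, and the bound t for the measure of the set where
    |f| > f^*(t). On the other side, the rearranged coefficients are reached through sums of |c_n|^2
    over finite sets of indices. *)

(** * Step functions below integrals, on the intervals ]4^-(j+1), 4^-j[ *)

Section integral_lower_bounds.
Context {R : realType}.
Notation mu := (@lebesgue_measure R).

(** The integral of a nonnegative function is a supremum over the simple functions below it, hence
    monotone whether or not the functions are measurable. Integrals of f^* and of the weighted tails
    are thus compared without a proof of measurability. *)
Lemma ge0_le_integral_nomeas (D : set R) (f g : R -> \bar R) :
  (forall x, D x -> (0 <= f x)%E) -> (forall x, D x -> (f x <= g x)%E) ->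
  (\int[mu]_(x in D) f x <= \int[mu]_(x in D) g x)%E.
Proof.
move=> f0 fg; rewrite [leLHS]integral_mkcond [leRHS]integral_mkcond.
have fg' x : ((f \_ D) x <= (g \_ D) x)%E.
  by rewrite /patch; case: ifPn => //; rewrite inE => /fg.
rewrite !ge0_integralTE.
- apply: le_ereal_sup => _ [h /= hf <-].
  by exists h => // x; exact: le_trans (hf x) (fg' x).
- by move=> x; rewrite /patch; case: ifPn => //; rewrite inE => Dx;
    apply: le_trans (fg _ Dx); exact: f0.
- by move=> x; rewrite /patch; case: ifPn => //; rewrite inE => /f0.
Qed.

Definition quart_itv (j : nat) : set R := `]4%:R^-j.+1, 4%:R^-j[.

Lemma measurable_quart_itv j :
  measurable (quart_itv j : set (measurableTypeR R)).
Proof. exact: measurable_itv. Qed.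

Lemma lebesgue_quart_itv j : mu (quart_itv j) = (3%:R / 4%:R * 4%:R^-j)%:E.
Proof.
rewrite /quart_itv lebesgue_measure_itv/= lte_fin.
have j0 : 0 < (4%:R^-j : R) by rewrite invr_gt0 exprn_gt0// ltr0n.
have -> : (4%:R^-j.+1 : R) = 4%:R^-j / 4%:R by rewrite exprS invfM mulrC.
rewrite ifT; last by lra.
by rewrite -EFinD; congr EFin; lra.
Qed.

(** The intervals are disjoint, so at most one summand is nonzero: a point of the last interval lies
    to the left of all earlier ones. *)
Lemma quart_step_le (N : nat) (a : nat -> R) (y : \bar R) (x : R) :
  (0 <= y)%E -> (forall j, (j < N)%N -> quart_itv j x -> ((a j)%:E <= y)%E) ->
  ((\sum_(j < N) a j * \1_(quart_itv j) x)%:E <= y)%E.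
Proof.
elim: N => [|N IH] y0 H; first by rewrite big_ord0.
rewrite big_ord_recr /=.
have [xN|xN] := pselect (quart_itv N x); last first.
  by rewrite indicE memNset// mulr0 addr0; apply: IH => // j jN; apply: H; exact: ltnW.
rewrite big1 ?add0r => [|j _]; first by rewrite indicE mem_set// mulr1; exact: H.
rewrite indicE memNset ?mulr0//= /quart_itv/= in_itv/= => /andP[xj _].
move: xN; rewrite /quart_itv/= in_itv/= => /andP[_].
apply/negP; rewrite -leNgt (le_trans _ (ltW xj))// lef_pV2 ?posrE ?exprn_gt0 ?ltr0n//.
by rewrite ler_eXn2l ?ltr1n.
Qed.

Lemma quart_step_le_integral (D : set R) (G : R -> \bar R) (N : nat)
    (a : nat -> R) :
  measurable D -> (forall j, 0 <= a j) -> (forall x, D x -> (0 <= G x)%E) ->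
  (forall j, (j < N)%N -> quart_itv j `<=` D) ->
  (forall j x, (j < N)%N -> quart_itv j x -> ((a j)%:E <= G x)%E) ->
  ((\sum_(j < N) a j * (3%:R / 4%:R * 4%:R^-j))%:E <= \int[mu]_(x in D) G x)%E.
Proof.
move=> mD a0 G0 sD aG.
apply: (@le_trans _ _ (\int[mu]_(x in D) (\sum_(j < N) a j * \1_(quart_itv j) x)%:E)%E).
  under eq_integral do rewrite -sumEFin.
  rewrite ge0_integral_sum//; last 2 first.
  - move=> j; apply/measurable_EFinP; apply: measurable_funM => //; apply: measurable_indic; exact: measurable_quart_itv.
  - by move=> j x _; rewrite lee_fin mulr_ge0// indicE.
  rewrite -sumEFin; apply: lee_sum => j _.
  under eq_integral do rewrite EFinM.
  rewrite ge0_integralZl//; last 2 first.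
  - by apply/measurable_EFinP; apply: measurable_indic; exact: measurable_quart_itv.
  - by rewrite lee_fin.
  rewrite integral_indic//; last exact: measurable_quart_itv.
  rewrite (_ : _ `&` _ = quart_itv j); last by apply/setIidPl; exact: sD.
  by rewrite EFinM; apply: lee_wpmul2l; [rewrite lee_fin|rewrite -lebesgue_quart_itv].
apply: ge0_le_integral_nomeas => x Dx.
  by rewrite lee_fin sumr_ge0// => j _; rewrite mulr_ge0// indicE.
by apply: quart_step_le => [|j jN xj]; [exact: G0|exact: aG].
Qed.

End integral_lower_bounds.

(** * The rearrangement of a sequence, and sums over finite sets of indices *)

Section sequence_rearrangement.
Context {R : realType}.

Lemma cnorm_ge0 (z : R[i]) : 0 <= cnorm z.
Proof. by case: z => a b; exact: sqrtr_ge0. Qed.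

Lemma sqr_cnorm (z : R[i]) :
  cnorm z ^+ 2 = complex.Re z ^+ 2 + complex.Im z ^+ 2.
Proof. by case: z => a b /=; rewrite sqr_sqrtr// addr_ge0 ?sqr_ge0. Qed.

Lemma card_le_seq (T : choiceType) (A : set T) (s : seq T) :
  A `<=` [set` s] -> (A #<= `I_(size s))%card.
Proof.
move=> As; have [->|/set0P[x0 _]] := eqVneq A set0; first exact: card_ge0.
apply: card_le_trans (subset_card_le As) _.
apply: card_le_trans (card_image_le (nth x0 s) _).
apply: subset_card_le => x /= /(nthP x0)[i ilt <-].
by exists i.
Qed.

Lemma seq_rearrangement_ge0 (k : index_kind) (c : sys_index k -> R[i]) (i : nat) :
  (0 <= seq_rearrangement c i)%E.
Proof. by apply: le_ereal_inf_tmp => _ [s [s0 _] <-]; rewrite lee_fin. Qed.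

(* Indices at which the moduli exceed 3/4 of the rearrangement are chosen
   greedily; the loss of a constant avoids the question whether the
   rearrangement is attained. *)
Lemma seq_rearrangement_sum_le (k : index_kind) (c : sys_index k -> R[i])
    (N : nat) (D : R) : 0 <= D ->
  (forall s : seq (sys_index k), uniq s -> (size s <= N)%N ->
     \sum_(n <- s) cnorm (c n) ^+ 2 <= D) ->
  (\sum_(1 <= i < N.+1) seq_rearrangement c i ^+ 2 <= (2%:R * D)%:E)%E.
Proof.
move=> D0 HD.
suff H m : (m <= N)%N -> exists s : seq (sys_index k),
    [/\ uniq s, (size s <= m)%N &
     (\sum_(1 <= i < m.+1) seq_rearrangement c i ^+ 2 <=
      (2%:R * \sum_(n <- s) cnorm (c n) ^+ 2)%:E)%E].
  have [s [us ss Hs]] := H N (leqnn N).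
  by apply: le_trans Hs _; rewrite lee_fin ler_wpM2l// HD.
elim: m => [|m IH] mN.
  by exists [::]; split => //; rewrite big_geq// big_nil mulr0.
have [s [us ss Hs]] := IH (ltnW mN).
rewrite big_nat_recr//=.
set r := seq_rearrangement c m.+1.
have rD : (r <= (Num.sqrt D)%:E)%E.
  apply: ereal_inf_lbound; exists (Num.sqrt D) => //; split; first exact: sqrtr_ge0.
  rewrite (_ : [set _ | _] = set0) ?card_ge0//.
  apply/seteqP; split => // n /=; apply/negP; rewrite -leNgt.
  rewrite -(ger0_norm (cnorm_ge0 (c n))) -sqrtr_sqr ler_wsqrtr//.
  have := HD [:: n]; rewrite big_seq1; apply => //.
  by apply: leq_trans mN.
have r0 : (0 <= r)%E by exact: seq_rearrangement_ge0.
have rfin : r \is a fin_num by rewrite ge0_fin_numE// (le_lt_trans rD)// ltry.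
have [req|rn0] := eqVneq r 0%E.
  exists s; split => //; first exact: leqW.
  by rewrite req ?expe2 mule0 adde0.
have rp : 0 < fine r by rewrite fine_gt0// lt_neqAle eq_sym rn0 r0/= ltey_eq rfin.
(* Otherwise every index with modulus above 3/4 of [r] lies in [s], which has at most m elements,
   and the infimum defining [r] would be at most 3/4 of [r]. *)
have [n [nr ns]] : exists n, 3%:R / 4%:R * fine r < cnorm (c n) /\ n \notin s.
  apply: contrapT => Hn.
  have : (r <= (3%:R / 4%:R * fine r)%:E)%E.
    apply: ereal_inf_lbound; exists (3%:R / 4%:R * fine r) => //; split.
      by rewrite mulr_ge0// ltW.
    apply: card_le_trans (card_le_seq _) _; last by rewrite card_le_II; exact: ss.
    move=> n /= nr; apply: contrapT => /negP ns; apply: Hn.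
    by exists n.
  rewrite -[X in (X <= _)%E](fineK rfin) lee_fin; lra.
exists (n :: s); split => /=; rewrite ?ns//.
rewrite big_cons mulrDr EFinD addeC; apply: leeD => //.
(* The factor 2 in the bound suffices because 2 (3/4)^2 = 9/8 > 1. *)
rewrite -(fineK rfin) -EFinM lee_fin.
have n0 := cnorm_ge0 (c n).
nra.
Qed.

End sequence_rearrangement.

(** * Complex-valued integrals over the unit interval *)

Section complex_integral.
Context {R : realType}.
Notation mu := (@lebesgue_measure R).
Implicit Types (u v w : R -> R[i]) (c z : R[i]).

Lemma ReM z c : complex.Re (z * c) =
  complex.Re z * complex.Re c - complex.Im z * complex.Im c.
Proof. by case: z c => [a b] [d e]. Qed.

Lemma ImM z c : complex.Im (z * c) =
  complex.Re z * complex.Im c + complex.Im z * complex.Re c.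
Proof. by case: z c => [a b] [d e]. Qed.

Lemma Re_conj z : complex.Re z^* = complex.Re z.
Proof. by case: z. Qed.

Lemma Im_conj z : complex.Im z^* = - complex.Im z.
Proof. by case: z. Qed.

Lemma ReD z c : complex.Re (z + c) = complex.Re z + complex.Re c.
Proof. by case: z c => [a b] [d e]. Qed.

Lemma ImD z c : complex.Im (z + c) = complex.Im z + complex.Im c.
Proof. by case: z c => [a b] [d e]. Qed.

Definition complexE := (ReM, ImM, Re_conj, Im_conj, ReD, ImD).

Lemma complex_ext z c :
  complex.Re z = complex.Re c -> complex.Im z = complex.Im c -> z = c.
Proof. by case: z c => [a b] [d e] /= -> ->. Qed.

Lemma cnorm_conj z : cnorm z^* = cnorm z.
Proof. by case: z => a b /=; rewrite sqrrN. Qed.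

Lemma normr_Re_le z : `|complex.Re z| <= cnorm z.
Proof.
rewrite -(@ler_pXn2r _ 2)// ?nnegrE ?cnorm_ge0//.
by rewrite sqr_cnorm real_normK ?num_real// lerDl sqr_ge0.
Qed.

Lemma normr_Im_le z : `|complex.Im z| <= cnorm z.
Proof.
rewrite -(@ler_pXn2r _ 2)// ?nnegrE ?cnorm_ge0//.
by rewrite sqr_cnorm real_normK ?num_real// lerDr sqr_ge0.
Qed.

Lemma measurable_unit_itv : measurable (@unit_itv R : set (measurableTypeR R)).
Proof. exact: measurable_itv. Qed.
Hint Resolve measurable_unit_itv : core.

Lemma cmeasurable_cnorm u :
  cmeasurable u -> measurable_fun unit_itv (fun x => cnorm (u x)).
Proof.
move=> [mr mi]; rewrite (_ : (fun _ => _) =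
    (@Num.sqrt R) \o (fun x => complex.Re (u x) ^+ 2 + complex.Im (u x) ^+ 2)).
  apply: measurableT_comp; first exact: (continuous_measurable_fun (@sqrt_continuous R)).
  by apply: measurable_funD; exact: measurable_funX.
by apply/funext => x /=; case: (u x).
Qed.

Lemma cmeasurableM u v :
  cmeasurable u -> cmeasurable v -> cmeasurable (fun x => u x * v x).
Proof.
move=> [ur ui] [vr vi]; split.
  under eq_fun do rewrite ReM.
  by apply: measurable_funB; exact: measurable_funM.
under eq_fun do rewrite ImM.
by apply: measurable_funD; exact: measurable_funM.
Qed.

Lemma cmeasurable_conj u : cmeasurable u -> cmeasurable (fun x => (u x)^*).
Proof.
move=> [ur ui]; split; first by under eq_fun do rewrite Re_conj.
under eq_fun do rewrite Im_conj.
exact: measurableT_comp.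
Qed.

Lemma cmeasurableD u v :
  cmeasurable u -> cmeasurable v -> cmeasurable (fun x => u x + v x).
Proof.
move=> [ur ui] [vr vi]; split.
  by under eq_fun do rewrite ReD; exact: measurable_funD.
by under eq_fun do rewrite ImD; exact: measurable_funD.
Qed.

Lemma cmeasurable_cst c : cmeasurable (fun=> c : R[i]).
Proof. by split; exact: measurable_cst. Qed.

Definition cintegrable u := [/\ cmeasurable u,
  mu.-integrable unit_itv (EFin \o (fun x => complex.Re (u x))) &
  mu.-integrable unit_itv (EFin \o (fun x => complex.Im (u x)))].

Lemma cintegrable_le u (g : R -> R) : cmeasurable u ->
  measurable_fun unit_itv g ->
  (\int[mu]_(x in unit_itv) (g x)%:E < +oo)%E ->
  (forall x, unit_itv x -> 0 <= g x) ->
  (\forall x \ae mu, unit_itv x -> cnorm (u x) <= g x) -> cintegrable u.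
Proof.
move=> mu_ mg gfin g0 ug.
have H (h : R -> R) : measurable_fun unit_itv h ->
    (forall x, `|h x| <= cnorm (u x)) ->
    mu.-integrable unit_itv (EFin \o h).
  move=> mh hu; apply/integrableP; split; first exact/measurable_EFinP.
  apply: le_lt_trans gfin; apply: ae_ge0_le_integral => //.
  - by apply/measurable_EFinP; exact: measurableT_comp.

  - exact/measurable_EFinP.
  - apply: (@filterS _ _ (ae_filter_ringOfSetsType _)) ug => x ux Ux /=; by rewrite lee_fin (le_trans (hu x))// ux.
case: (mu_) => mr mi; split => //.
  by apply: H => // x; exact: normr_Re_le.
by apply: H => // x; exact: normr_Im_le.
Qed.

Lemma cintegralD u v : cintegrable u -> cintegrable v ->
  cintegral (fun x => u x + v x) = cintegral u + cintegral v.
Proof.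
move=> [_ ur ui] [_ vr vi]; apply: complex_ext; rewrite /cintegral !complexE/=.
  under eq_Rintegral do rewrite ReD.
  by rewrite RintegralD.
under eq_Rintegral do rewrite ImD.
by rewrite RintegralD.
Qed.

Lemma cintegrableM c u : cintegrable u -> cintegrable (fun x => c * u x).
Proof.
move=> [mu_ ur ui]; split; first exact: cmeasurableM (cmeasurable_cst _) mu_.
  rewrite (_ : _ \o _ = (fun x => (complex.Re c)%:E * (complex.Re (u x))%:E -
                      (complex.Im c)%:E * (complex.Im (u x))%:E)%E).
    by apply: integrableB => //; exact: integrableZl.
  by apply/funext => x /=; rewrite ReM EFinB !EFinM.
rewrite (_ : _ \o _ = (fun x => (complex.Re c)%:E * (complex.Im (u x))%:E +
                      (complex.Im c)%:E * (complex.Re (u x))%:E)%E).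
  by apply: integrableD => //; exact: integrableZl.
by apply/funext => x /=; rewrite ImM EFinD !EFinM.
Qed.

Lemma integrable_scale (h : R -> R) (r : R) :
  mu.-integrable unit_itv (EFin \o h) ->
  mu.-integrable unit_itv (EFin \o (fun x => r * h x)).
Proof.
move=> ih; rewrite (_ : _ \o _ = (fun x => r%:E * (h x)%:E)%E); first exact: integrableZl.
by apply/funext => x /=; rewrite EFinM.
Qed.

Lemma cintegralM c u : cintegrable u ->
  cintegral (fun x => c * u x) = c * cintegral u.
Proof.
move=> [_ ur ui]; apply: complex_ext; rewrite /cintegral !complexE/=.
  under eq_Rintegral do rewrite ReM.
  rewrite RintegralB//; last 2 first.
  - exact: integrable_scale.
  - exact: integrable_scale.
  by rewrite !RintegralZl.
under eq_Rintegral do rewrite ImM.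
rewrite RintegralD//; last 2 first.
- exact: integrable_scale.
- exact: integrable_scale.
by rewrite !RintegralZl.
Qed.

End complex_integral.

(** * Bessel's inequality *)

Section bessel.
Context {R : realType}.
Notation mu := (@lebesgue_measure R).
Implicit Types (u v w : R -> R[i]) (c z : R[i]).

Lemma in_L2_lin u w c : in_L2 u -> in_L2 w -> in_L2 (fun x => u x + c * w x).
Proof.
move=> [mu_ u2] [mw w2].
have mcw : cmeasurable (fun x => c * w x).
  exact: cmeasurableM (cmeasurable_cst _) mw.
have mD := cmeasurableD mu_ mcw.
split => //.
have msq v : cmeasurable v -> measurable_fun unit_itv (fun x => (cnorm (v x) ^+ 2)%:E).
  move=> mv; apply/measurable_EFinP; apply: measurable_funX.
  exact: cmeasurable_cnorm.
have mU := @measurable_unit_itv R.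
pose b := 2%:R * cnorm c ^+ 2.
have b0 : 0 <= b by rewrite mulr_ge0// sqr_ge0.
apply: (@le_lt_trans _ _ (\int[mu]_(x in unit_itv)
  (2%:E * (cnorm (u x) ^+ 2)%:E + b%:E * (cnorm (w x) ^+ 2)%:E))%E).
  apply: ge0_le_integral_nomeas => x _; first by rewrite lee_fin sqr_ge0.
  rewrite -!EFinM -EFinD lee_fin /b.
  have := le_normcD (u x) (c * w x); rewrite Normc.normcM.
  have := cnorm_ge0 (u x); have := cnorm_ge0 c; have := cnorm_ge0 (w x).
  have := cnorm_ge0 (u x + c * w x).
  set p := cnorm (u x + _); set q := cnorm (u x); set r := cnorm c.
  set s := cnorm (w x) => p0 s0 r0 q0 pq.
  apply: (@le_trans _ _ ((q + r * s) ^+ 2)); first by rewrite ler_sqr ?nnegrE ?addr_ge0 ?mulr_ge0.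
  have := sqr_ge0 (q - r * s); nra.
rewrite ge0_integralD//; last 4 first.
- by move=> x _; rewrite -EFinM lee_fin mulr_ge0// sqr_ge0.
- by apply: measurable_funeM; exact: msq.
- by move=> x _; rewrite -EFinM lee_fin mulr_ge0// sqr_ge0.
- by apply: measurable_funeM; exact: msq.
rewrite ge0_integralZl//; last 2 first.
- exact: msq.
- by move=> x _; rewrite lee_fin sqr_ge0.
rewrite ge0_integralZl//; last 2 first.
- exact: msq.
- by move=> x _; rewrite lee_fin sqr_ge0.
by rewrite lte_add_pinfty// lte_mul_pinfty// lee_fin.
Qed.

(** The product is dominated by |u|^2 + |v|^2. *)
Lemma cintegrable_in_L2 u v : in_L2 u -> in_L2 v ->
  cintegrable (fun x => u x * (v x)^*).
Proof.
move=> [mu_ u2] [mv v2].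
have mU := @measurable_unit_itv R.
have msq w : cmeasurable w -> measurable_fun unit_itv (fun x => cnorm (w x) ^+ 2).
  move=> mw; apply: measurable_funX; exact: cmeasurable_cnorm.
have mE w : cmeasurable w -> measurable_fun unit_itv (fun x => (cnorm (w x) ^+ 2)%:E).
  by move=> mw; apply/measurable_EFinP; exact: msq.
apply: (@cintegrable_le _ _ (fun x => cnorm (u x) ^+ 2 + cnorm (v x) ^+ 2)).
- by apply: cmeasurableM => //; exact: cmeasurable_conj.
- by apply: measurable_funD; exact: msq.
- under eq_integral do rewrite EFinD.
  rewrite ge0_integralD//; last 4 first.
  + by move=> x _; rewrite lee_fin sqr_ge0.
  + exact: mE.
  + by move=> x _; rewrite lee_fin sqr_ge0.
  + exact: mE.
  by rewrite lte_add_pinfty.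
- by move=> x _; rewrite addr_ge0// sqr_ge0.
- apply: aeW => x _; rewrite Normc.normcM cnorm_conj.
  have := cnorm_ge0 (u x); have := cnorm_ge0 (v x).
  set p := cnorm (u x); set q := cnorm (v x) => p0 q0.
  have := sqr_ge0 (p - q); nra.
Qed.

Lemma inner_L2_lin u w v c : in_L2 u -> in_L2 w -> in_L2 v ->
  inner_L2 (fun x => u x + c * w x) v = inner_L2 u v + c * inner_L2 w v.
Proof.
move=> u2 w2 v2; rewrite /inner_L2.
under [in LHS]eq_fun do rewrite mulrDl -mulrA.
rewrite cintegralD ?cintegralM//; try exact: cintegrable_in_L2.
by apply: cintegrableM; exact: cintegrable_in_L2.
Qed.

Lemma inner_L2_conj u v : in_L2 u -> in_L2 v ->
  inner_L2 v u = (inner_L2 u v)^*.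
Proof.
move=> u2 v2; have [_ ri ii] := cintegrable_in_L2 u2 v2.
apply: complex_ext; rewrite ?complexE /=.
  by apply: eq_Rintegral => x _; rewrite !complexE; ring.
rewrite -mulN1r -RintegralZl//; last exact: measurable_unit_itv.
by apply: eq_Rintegral => x _; rewrite !complexE; ring.
Qed.

(** The squared L2 norm as a real number, which turns the induction for Bessel's inequality into
    algebra in [R]. *)
Definition energy u : R := complex.Re (inner_L2 u u).

Lemma energyE u : in_L2 u ->
  (energy u)%:E = (\int[mu]_(x in unit_itv) (cnorm (u x) ^+ 2)%:E)%E.
Proof.
move=> u2; rewrite /energy /=.
have -> : \int[mu]_(x in unit_itv) complex.Re (u x * (u x)^*) =
    \int[mu]_(x in unit_itv) (cnorm (u x) ^+ 2).
  by apply: eq_Rintegral => x _; rewrite !complexE sqr_cnorm; ring.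
rewrite /Rintegral fineK// ge0_fin_numE//; first by case: u2.
by apply: integral_ge0 => x _; rewrite lee_fin sqr_ge0.
Qed.

(** Pythagoras: the component along a unit vector is removed. *)
Lemma energy_sub u w : in_L2 u -> in_L2 w -> inner_L2 w w = 1 ->
  energy (fun x => u x + - inner_L2 u w * w x) =
  energy u - cnorm (inner_L2 u w) ^+ 2.
Proof.
move=> u2 w2 w1; set c := inner_L2 u w; rewrite /energy.
have v2 : in_L2 (fun x => u x + - c * w x) by exact: in_L2_lin.
rewrite inner_L2_lin//.
rewrite (inner_L2_conj v2 u2) (inner_L2_conj v2 w2) !inner_L2_lin//.
rewrite w1 (inner_L2_conj u2 w2) -/c sqr_cnorm !complexE/=.
by rewrite /c; ring.
Qed.

(** Induction on [s] for all [u] at once: removing the component along [phi n] lowers the energy by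
    exactly |c_n|^2 and, by orthogonality, leaves the coefficients at the other indices of [s]
    unchanged. *)
Lemma bessel (k : index_kind) (phi : sys_index k -> R -> R[i])
    (s : seq (sys_index k)) u :
  orthonormal_system phi -> in_L2 u -> uniq s ->
  ((\sum_(n <- s) cnorm (fourier_coef phi u n) ^+ 2)%:E <=
   \int[mu]_(x in unit_itv) (cnorm (u x) ^+ 2)%:E)%E.
Proof.
move=> [phi2 orth] u2 us; rewrite -energyE// lee_fin.
elim: s u u2 us => [|n s IH] u u2.
  move=> _; rewrite big_nil -lee_fin energyE//.
  by apply: integral_ge0 => x _; rewrite lee_fin sqr_ge0.
rewrite cons_uniq big_cons => /andP[ns us].
pose v x := u x + - inner_L2 u (phi n) * phi n x.
have v2 : in_L2 v by exact: in_L2_lin.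
have := IH v v2 us; rewrite energy_sub//; last by rewrite orth eqxx.
rewrite lerBrDl; apply: le_trans; rewrite lerD2l.
rewrite le_eqVlt; apply/orP; left; apply/eqP; apply: eq_big_seq => m ms.
suff -> : fourier_coef phi u m = fourier_coef phi v m by [].
rewrite /fourier_coef -/(inner_L2 u (phi m)) -/(inner_L2 v (phi m)).
rewrite /v inner_L2_lin// orth.
have /negPf -> : n != m by apply: contraNneq ns => ->.
by rewrite mulr0 addr0.
Qed.

End bessel.

(** * Superlevel sets and the rearrangement of a function *)

Lemma lebesgue_unit_itv {R : realType} : lebesgue_measure (@unit_itv R) = 1%E.
Proof. by rewrite /unit_itv lebesgue_measure_itv/= lte_fin ltr01 oppr0 adde0. Qed.

Section layers.
Context {R : realType}.
Notation mu := (@lebesgue_measure R).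
Implicit Types (f : R -> R[i]).

Definition superlevel f (s : R) : set R := [set x | unit_itv x /\ s < cnorm (f x)].

Lemma measurable_superlevel f s : cmeasurable f ->
  measurable (superlevel f s : set (measurableTypeR R)).
Proof.
move=> mf; have := cmeasurable_cnorm mf (@measurable_unit_itv R)
  (measurable_itv `]s, +oo[).
congr (measurable _); apply/seteqP; split => x /= [Ux]; rewrite in_itv/= andbT.
  by [].
by split => //=; rewrite in_itv/= andbT.
Qed.

Lemma superlevel_sub f s t : s <= t -> superlevel f t `<=` superlevel f s.
Proof. by move=> st x [Ux tx]; split => //; exact: le_lt_trans tx. Qed.

Lemma mu_superlevel_le f s t : cmeasurable f -> s <= t ->
  (mu (superlevel f t) <= mu (superlevel f s))%E.
Proof.
move=> mf st; apply: le_measure; rewrite ?inE; last exact: superlevel_sub.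
  exact: measurable_superlevel.
exact: measurable_superlevel.
Qed.

Lemma fun_rearrangement_ge0 f t : (0 <= fun_rearrangement f t)%E.
Proof. by apply: le_ereal_inf_tmp => _ [s [s0 _] <-]; rewrite lee_fin. Qed.

Lemma fun_rearrangement_antitone f s t : s <= t ->
  (fun_rearrangement f t <= fun_rearrangement f s)%E.
Proof.
move=> st; apply: ereal_inf_le_tmp => _ [r [r0 rs] <-]; exists r => //; split => //.
by apply: le_trans rs _; rewrite lee_fin.
Qed.

(** Every superlevel set lies in an interval of measure 1, so s = 0 is admissible in the infimum.
    This supplies the bottom level 0 of the layers. *)
Lemma fun_rearrangement1 f : cmeasurable f -> fun_rearrangement f 1 = 0%E.
Proof.
move=> mf; apply/eqP; rewrite eq_le fun_rearrangement_ge0 andbT.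
apply: ereal_inf_lbound; exists 0 => //; split => //.
apply: (@le_trans _ _ (mu (@unit_itv R))).
  apply: le_measure; rewrite ?inE; last by move=> x [].
    exact: measurable_superlevel.
  exact: measurable_unit_itv.
by rewrite lebesgue_unit_itv.
Qed.

(** The infimum defining f^*(t) is attained: the superlevel set at [L] is the increasing union of
    those at L + 1/(n+1), each of measure at most t, and the measure is continuous from below. *)
Lemma mu_superlevel_rearrangement f (t L : R) : cmeasurable f ->
  fun_rearrangement f t = L%:E -> (mu (superlevel f L) <= t%:E)%E.
Proof.
move=> mf fL; pose F (n : nat) := superlevel f (L + n.+1%:R^-1).
have UF : superlevel f L = \bigcup_n F n.
  apply/seteqP; split => [x [Ux Lx]|x [n _]]; last first.
    by apply: superlevel_sub; rewrite lerDl invr_ge0.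
  have d0 : 0 < cnorm (f x) - L by rewrite subr_gt0.
  exists (Num.truncn ((cnorm (f x) - L)^-1)) => //; split => //.
  rewrite -ltrBrDl invf_plt ?posrE//.
  exact: truncnS_gt.
have mF n : measurable (F n : set (measurableTypeR R)).
  exact: measurable_superlevel.
have := @nondecreasing_cvg_mu _ _ _ mu F mF.
rewrite -UF => /(_ (measurable_superlevel _ mf)) cF.
have {}cF : mu \o F @ \oo --> mu (superlevel f L).
  apply: cF => m n mn; apply/subsetPset; apply: superlevel_sub.
  by rewrite lerD2l lef_pV2 ?posrE// ler_nat ltnS.
rewrite -(cvg_lim _ cF)//; apply: lime_le; first by apply/cvgP: cF.
apply: nearW => n /=.
have : (fun_rearrangement f t < (L + n.+1%:R^-1)%:E)%E.
  by rewrite fL lte_fin ltrDl invr_gt0.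
move=> /ereal_inf_lt [_ [s [s0 st] <-]]; rewrite lte_fin => sn.
by apply: le_trans st; apply: mu_superlevel_le => //; exact: ltW.
Qed.

End layers.

(** * Splitting a function along a ladder of levels *)

Section truncation.
Context {R : realType}.
Notation mu := (@lebesgue_measure R).
(* [L j] stands for f^*(4^-j), so that |f| lies in ]L j, L (j+1)] on a set of
   measure at most 4^-j. *)
Variables (f : R -> R[i]) (L : nat -> R).
Hypothesis mf : cmeasurable f.
Hypothesis L0 : L 0%N = 0.
Hypothesis L_ge0 : forall j, 0 <= L j.
Hypothesis mu_L : forall j, (mu (superlevel f (L j)) <= (4%:R^-j)%:E)%E.

Definition low_part (J : nat) : R -> R[i] :=
  fun x => f x * (\1_(~` superlevel f (L J)) x)%:C.

Definition high_part (J : nat) : R -> R[i] :=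
  fun x => f x * (\1_(superlevel f (L J)) x)%:C.

Lemma low_high_part J x : f x = low_part J x + high_part J x.
Proof.
rewrite /low_part /high_part -mulrDr -rmorphD/= !indicE in_setC.
by case: (x \in _); rewrite /= ?addr0 ?add0r mulr1.
Qed.

Lemma cnormC (a : R) : cnorm (a%:C) = `|a|.
Proof. by rewrite /= expr0n/= addr0 sqrtr_sqr. Qed.

Lemma cmeasurable_indic (A : set R) : measurable (A : set (measurableTypeR R)) ->
  cmeasurable (fun x => (\1_A x)%:C : R[i]).
Proof.
move=> mA; split => /=; last exact: measurable_cst.
by apply: measurable_indic.
Qed.

Lemma cmeasurable_low_part J : cmeasurable (low_part J).
Proof.
apply: cmeasurableM => //; apply: cmeasurable_indic.
by apply: measurableC; exact: measurable_superlevel.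
Qed.

Lemma cmeasurable_high_part J : cmeasurable (high_part J).
Proof.
by apply: cmeasurableM => //; apply: cmeasurable_indic; exact: measurable_superlevel.
Qed.

Lemma integral_superlevel_le (a : R) j : 0 <= a ->
  (\int[mu]_(x in unit_itv) (a * \1_(superlevel f (L j)) x)%:E <=
    (a * 4%:R^-j)%:E)%E.
Proof.
move=> a0; under eq_integral do rewrite EFinM.
have mS : measurable (superlevel f (L j) : set (measurableTypeR R)).
  exact: measurable_superlevel.
have mU := @measurable_unit_itv R.
rewrite ge0_integralZl//; last by apply/measurable_EFinP; exact: measurable_indic.
rewrite integral_indic// EFinM lee_wpmul2l ?lee_fin//.
by apply: le_trans (mu_L j); apply: le_measure; rewrite ?inE//; apply: measurableI.
Qed.

(** Descending from [J] one meets an index with L j < y <= L (j+1), unless y = 0; the summand at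
    that index alone dominates y^2. *)
Lemma sqr_le_layers J y (b : nat -> bool) :
  0 <= y -> y <= L J -> (forall j, L j < y -> b j) ->
  y ^+ 2 <= \sum_(j < J) L j.+1 ^+ 2 * (b j)%:R.
Proof.
move=> y0 + yb; elim: J => [|J IH] yL.
  by rewrite big_ord0 (_ : y = 0) ?expr0n//; apply/eqP; rewrite eq_le y0 -L0 yL.
have [/IH{}IH|/yb bJ] := leP y (L J); rewrite big_ord_recr/=.
  by apply: (le_trans IH); rewrite lerDl mulr_ge0// sqr_ge0.
rewrite bJ mulr1; apply: (@le_trans _ _ (L J.+1 ^+ 2)).
  by rewrite ler_sqr ?nnegrE.
by rewrite lerDr sumr_ge0// => j _; rewrite mulr_ge0// sqr_ge0.
Qed.

Lemma low_part_energy J :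
  (\int[mu]_(x in unit_itv) (cnorm (low_part J x) ^+ 2)%:E <=
   (\sum_(j < J) L j.+1 ^+ 2 * 4%:R^-j)%:E)%E.
Proof.
apply: (@le_trans _ _ (\int[mu]_(x in unit_itv)
   \sum_(j < J) (L j.+1 ^+ 2 * \1_(superlevel f (L j)) x)%:E)%E).
  apply: ge0_le_integral_nomeas => x Ux; first by rewrite lee_fin sqr_ge0.
  rewrite sumEFin lee_fin /low_part Normc.normcM cnormC indicE in_setC normr_nat.
  have [xJ|xJ] := boolP (x \in superlevel f (L J)).
    rewrite mulr0 expr0n/= sumr_ge0// => j _.
    by rewrite mulr_ge0 ?sqr_ge0// indicE.
  rewrite mulr1; under eq_bigr do rewrite indicE.
  apply: (@sqr_le_layers _ _ (fun j => x \in superlevel f (L j))) => [||j Lj].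
    exact: cnorm_ge0.
    rewrite leNgt; apply: contra xJ => xJ; rewrite inE; by split.
  by rewrite inE; split.
have mU := @measurable_unit_itv R.
rewrite ge0_integral_sum//; last 2 first.
- move=> j; apply/measurable_EFinP; apply: measurable_funM => //.
  by apply: measurable_indic; exact: measurable_superlevel.
- by move=> j x _; rewrite lee_fin mulr_ge0 ?sqr_ge0// indicE.
rewrite -sumEFin; apply: lee_sum => j _.
by apply: integral_superlevel_le; rewrite sqr_ge0.
Qed.

(** Points where |f| exceeds all the levels belong to no layer. The measure of their set is at most
    4^-(J+j) for every j, so [high_part_norm] may discard them. *)
Lemma layers_null J : mu (\bigcap_j superlevel f (L (J + j))) = 0%E.
Proof.
apply/eqP; rewrite eq_le measure_ge0 andbT.
have c4 : (4%:R^-j : R)%:E @[j --> \oo] --> 0%E.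
  apply: cvg_EFin; first exact: nearW.
  apply: (@cvg_trans _ ((4%:R^-1 : R) ^+ j @[j --> \oo])).
    by apply: near_eq_cvg; apply: nearW => j /=; rewrite exprVn.
  by apply: cvg_expr; rewrite ger0_norm// invf_lt1// ltr1n.
rewrite -(cvg_lim _ c4)//; apply: lime_ge; first by apply/cvgP: c4.
apply: nearW => j; apply: (@le_trans _ _ (4%:R^-(J + j))%:E); last first.
  by rewrite lee_fin lef_pV2 ?posrE ?exprn_gt0// ler_eXn2l ?ltr1n// leq_addl.
apply: le_trans (mu_L (J + j)).
have mS i : measurable (superlevel f (L i) : set (measurableTypeR R)).
  exact: measurable_superlevel.
apply: le_measure; rewrite ?inE//; first by apply: bigcap_measurableType => i _; exact: mS.
exact: bigcap_inf.
Qed.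

(** Almost every point where |f| exceeds [L J] lies in a layer with L (J+n) < |f| <= L (J+n+1),
    where the n-th term of the series dominates |f|; the series is then integrated term by term. *)
Lemma high_part_norm J (B : R) :
  (\sum_(0 <= m <oo) (L (J + m).+1 * 4%:R^-(J + m))%:E <= B%:E)%E ->
  (\int[mu]_(x in unit_itv) (cnorm (high_part J x))%:E <= B%:E)%E.
Proof.
move=> HB; apply: le_trans HB.
have mU := @measurable_unit_itv R.
have mS j : measurable (superlevel f (L j) : set (measurableTypeR R)).
  exact: measurable_superlevel.
pose F m x := (L (J + m).+1 * \1_(superlevel f (L (J + m))) x)%:E.
have mF m : measurable_fun unit_itv (F m).
  by apply/measurable_EFinP; apply: measurable_funM => //; apply: measurable_indic; exact: mS.
have F0 m x : (0 <= F m x)%E by rewrite lee_fin mulr_ge0// indicE.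
apply: (@le_trans _ _ (\int[mu]_(x in unit_itv) (\sum_(0 <= m <oo) F m x))%E); last first.
  rewrite integral_nneseries//.
  apply: lee_nneseries => m *; last exact: integral_superlevel_le.
  by apply: integral_ge0.
apply: ae_ge0_le_integral => //.
- by move=> x _; rewrite lee_fin cnorm_ge0.
- apply/measurable_EFinP; apply: cmeasurable_cnorm; exact: cmeasurable_high_part.
- by move=> x _; apply: nneseries_ge0.
- apply: (ge0_emeasurable_sum (P := xpredT)) => [k x _ _|k _]; [exact: F0|exact: mF].
exists (\bigcap_j superlevel f (L (J + j))); split.
- by apply: bigcap_measurableType => i _; exact: mS.
- exact: layers_null.
move=> x /= /not_implyP[Ux]; apply: contra_notP => Nx.
rewrite /high_part Normc.normcM cnormC indicE normr_nat.
have [xJ|_] := boolP (x \in superlevel f (L J)); last first.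
  by rewrite mulr0 nneseries_ge0.
rewrite mulr1.
have [m fm] : exists m, cnorm (f x) <= L (J + m).
  apply: contra_notP Nx => Nm j _; split => //.
  by rewrite ltNge; apply/negP => fj; apply: Nm; exists j.
(* The least such index is not 0, as |f x| > [L J], and its predecessor is the number of the layer
   containing x. *)
have [m' fm' minm'] := ex_minnP (ex_intro (fun m => cnorm (f x) <= L (J + m)) m fm).
case: m' fm' minm' => [|n] fn minn.
  by move: xJ; rewrite inE => -[_]; rewrite ltNge -(addn0 J) fn.
have nn : x \in superlevel f (L (J + n)).
  rewrite inE; split => //; rewrite ltNge; apply/negP => /minn; by rewrite ltnn.
apply: (@le_trans _ _ (F n x)).
  by rewrite /F indicE nn mulr1 lee_fin -addnS.
rewrite (nneseries_split 0 n.+1)//.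
rewrite big_mkord big_ord_recr/= -[leLHS]add0e -[leLHS]adde0.
apply: leeD; last exact: nneseries_ge0.
by apply: leeD => //; exact: sume_ge0.
Qed.

End truncation.

(** * Fourier coefficients of the two parts *)

Lemma sqr_add_le_norm {R : realType} (a b c : R) :
  `|a| <= c -> `|b| <= c -> a ^+ 2 + b ^+ 2 <= (2%:R * c) ^+ 2.
Proof. by rewrite !ler_norml => /andP[a1 a2] /andP[b1 b2]; nra. Qed.

Section fourier_bounds.
Context {R : realType} {k : index_kind}.
Notation mu := (@lebesgue_measure R).
Variables (phi : sys_index k -> R -> R[i]) (M : R).
Hypothesis phi_orth : orthonormal_system phi.
Hypothesis phi_bound : sup_norm phi = M%:E.

Lemma ae_cnorm_le_sup_norm n :
  \forall x \ae mu, unit_itv x -> cnorm (phi n x) <= M.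
Proof.
have : (Loo_norm (phi n) <= M%:E)%E.
  by rewrite -phi_bound; apply: ereal_sup_ubound; exists n.
rewrite /Loo_norm unlock.
(* The L-infinity norm is the essential supremum only when the whole space has positive measure, and
   a default value otherwise. *)
have U1 : (0 < unit_measure [set: R])%E.
  rewrite /unit_measure /= /mrestr setTI.
  by have := @lebesgue_unit_itv R; rewrite /unit_itv => ->; rewrite lte_fin.
rewrite ifT// => /ess_supP [N [mN N0 HN]].
exists (N `&` unit_itv); split => //.
  by apply: measurableI => //; exact: measurable_unit_itv.
move=> x /= /not_implyP[Ux Hx]; split => //; apply: HN => /=.
by apply: contra_not Hx; rewrite lee_fin ger0_norm ?cnorm_ge0.
Qed.

(** On an interval of measure 1, the squared L2 norm of [phi n], which equals 1, is at most M^2. *)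
Lemma sup_norm_ge1 : 1 <= M.
Proof.
have [n _] : exists n : sys_index k, True.
  by case: k => /=; [exists 0%N|exists 0].
have [phi2 orth] := phi_orth.
have M0 : 0 <= M.
  rewrite -lee_fin -phi_bound; apply: (@le_trans _ _ (Loo_norm (phi n))).
    exact: Lnorm_ge0.
  by apply: ereal_sup_ubound; exists n.
have mU := @measurable_unit_itv R.
have [mphi _] := phi2 n.
have : ((energy (phi n))%:E <= (M ^+ 2)%:E)%E.
  rewrite energyE//.
  apply: (@le_trans _ _ (\int[mu]_(x in unit_itv) (cst (M ^+ 2)%:E x))%E).
    apply: ae_ge0_le_integral => //.
    - by move=> x _; rewrite lee_fin sqr_ge0.
    - apply/measurable_EFinP; apply: measurable_funX; exact: cmeasurable_cnorm.
    - by move=> x _; rewrite lee_fin sqr_ge0.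
    apply: (@filterS _ _ (ae_filter_ringOfSetsType _)) (ae_cnorm_le_sup_norm n).
    by move=> x H /H xM; rewrite lee_fin ler_sqr ?nnegrE ?cnorm_ge0.
  rewrite integral_cst// [X in (_ * X)%E](_ : _ = 1%E) ?mule1//.
  exact: lebesgue_unit_itv.
rewrite lee_fin /energy orth eqxx/=; nra.
Qed.

(** Real and imaginary parts are bounded by M B separately, whence the factor 2. Integrability is
    part of the conclusion because [h] need not be in L2. *)
Lemma fourier_coef_L1 (h : R -> R[i]) (B : R) n : cmeasurable h ->
  (\int[mu]_(x in unit_itv) (cnorm (h x))%:E <= B%:E)%E ->
  cintegrable (fun x => h x * (phi n x)^*) /\
  cnorm (fourier_coef phi h n) <= 2%:R * (M * B).
Proof.
move=> mh hB.
have M0 : 0 <= M by exact: le_trans ler01 sup_norm_ge1.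
have mU := @measurable_unit_itv R.
have mch := cmeasurable_cnorm mh.
have [[mphi _] _] := (phi_orth.1 n, tt).
have mF : cmeasurable (fun x => h x * (phi n x)^*).
  by apply: cmeasurableM => //; exact: cmeasurable_conj.
have MB : (\int[mu]_(x in unit_itv) (M * cnorm (h x))%:E <= (M * B)%:E)%E.
  under eq_integral do rewrite EFinM.
  rewrite ge0_integralZl//; last 2 first.
  - exact/measurable_EFinP.
  - by move=> x _; rewrite lee_fin cnorm_ge0.
  by rewrite EFinM lee_wpmul2l.
have Fle : \forall x \ae mu, unit_itv x -> cnorm (h x * (phi n x)^*) <= M * cnorm (h x).
  apply: (@filterS _ _ (ae_filter_ringOfSetsType _)) (ae_cnorm_le_sup_norm n).
  move=> x H /H xM; rewrite Normc.normcM cnorm_conj mulrC.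
  by rewrite ler_wpM2r ?cnorm_ge0.
have mMh : measurable_fun unit_itv (fun x => M * cnorm (h x)).
  exact: measurable_funM.
have Fi : cintegrable (fun x => h x * (phi n x)^*).
  apply: (cintegrable_le mF mMh _ _ Fle); first by apply: (le_lt_trans MB); exact: ltry.
  by move=> x _; rewrite mulr_ge0 ?cnorm_ge0.
split => //.
have H (p : R -> R) : mu.-integrable unit_itv (EFin \o p) ->
   (forall x, `|p x| <= cnorm (h x * (phi n x)^*)) ->
   `|\int[mu]_(x in unit_itv) p x| <= M * B.
  move=> ip pF; apply: le_trans (le_normr_Rintegral mU ip) _.
  have pMB : (\int[mu]_(x in unit_itv) `|p x|%:E <= (M * B)%:E)%E.
    apply: le_trans MB; apply: ae_ge0_le_integral => //.
    - apply/measurable_EFinP; apply: measurableT_comp => //.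
      by case/integrableP: ip => /measurable_EFinP.
    - by move=> x _; rewrite lee_fin mulr_ge0 ?cnorm_ge0.
    - exact/measurable_EFinP.
    apply: (@filterS _ _ (ae_filter_ringOfSetsType _)) Fle => x H /H xM.
    by rewrite lee_fin; apply: le_trans xM.
  rewrite -lee_fin /Rintegral fineK// ge0_fin_numE ?(le_lt_trans pMB) ?ltry//.
  by apply: integral_ge0 => x _; rewrite lee_fin.
case: Fi => _ ri ii.
have Hr := H _ ri (fun x => normr_Re_le _).
have Hi := H _ ii (fun x => normr_Im_le _).
rewrite -(@ler_pXn2r _ 2)// ?nnegrE ?cnorm_ge0//; last first.
  by rewrite mulr_ge0// (le_trans _ Hr).
rewrite sqr_cnorm /fourier_coef /=.
exact: sqr_add_le_norm.
Qed.

(** By |a + b|^2 <= 2|a|^2 + 2|b|^2, Bessel's inequality yields 2 A for the low part, and the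
    uniform bound 2 M B on the coefficients of the high part yields 8 (M B)^2 per index. *)
Lemma fourier_coef_sum_le (f : R -> R[i]) (L : nat -> R) (J : nat) (A B : R)
    (s : seq (sys_index k)) :
  cmeasurable f -> L 0%N = 0 -> (forall j, 0 <= L j) ->
  (forall j, (mu (superlevel f (L j)) <= (4%:R^-j)%:E)%E) ->
  \sum_(j < J) L j.+1 ^+ 2 * 4%:R^-j <= A ->
  (\sum_(0 <= m <oo) (L (J + m).+1 * 4%:R^-(J + m))%:E <= B%:E)%E ->
  uniq s ->
  \sum_(n <- s) cnorm (fourier_coef phi f n) ^+ 2 <=
    2%:R * A + 8%:R * (size s)%:R * (M * B) ^+ 2.
Proof.
move=> mf L0 L_ge0 mu_L HA HB us.
have lowE := low_part_energy mf L0 L_ge0 mu_L J.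
have highE := high_part_norm mf L_ge0 mu_L HB.
have mlow := cmeasurable_low_part L mf J.
have mhigh := cmeasurable_high_part L mf J.
have low2 : in_L2 (low_part f L J).
  by split => //; apply: le_lt_trans lowE _; exact: ltry.
have := bessel phi_orth low2 us => /le_trans/(_ lowE); rewrite lee_fin.
move=> /le_trans/(_ HA) lowA.
have coefE n : fourier_coef phi f n =
    fourier_coef phi (low_part f L J) n + fourier_coef phi (high_part f L J) n.
  have [hi _] := fourier_coef_L1 n mhigh highE.
  rewrite /fourier_coef -cintegralD//.
    congr cintegral; apply/funext => x.
    by rewrite -mulrDl -low_high_part.
  by apply: cintegrable_in_L2 => //; exact: phi_orth.1.
apply: (@le_trans _ _ (\sum_(n <- s) (2%:R * cnorm (fourier_coef phi (low_part f L J) n) ^+ 2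
   + 8%:R * (M * B) ^+ 2))).
  apply: ler_sum => n _; rewrite coefE.
  have [_ hn] := fourier_coef_L1 n mhigh highE.
  have := le_normcD (fourier_coef phi (low_part f L J) n) (fourier_coef phi (high_part f L J) n).
  have := cnorm_ge0 (fourier_coef phi (low_part f L J) n).
  have := cnorm_ge0 (fourier_coef phi (high_part f L J) n).
  have := cnorm_ge0 (fourier_coef phi (low_part f L J) n + fourier_coef phi (high_part f L J) n).
  move: hn; set x := cnorm _; set y := cnorm (_ + _); set z := cnorm _.
  move=> xMB y0 x0 z0 yxz.
  apply: (@le_trans _ _ ((z + x) ^+ 2)); first by rewrite ler_sqr ?nnegrE ?addr_ge0.
  have := sqr_ge0 (z - x); nra.
rewrite big_split/= -mulr_sumr; apply: lerD; first exact: ler_wpM2l.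
by rewrite big_const_seq count_predT iter_addr_0 -[leLHS]mulr_natl mulrCA mulrA.
Qed.

End fourier_bounds.

(** * The estimate for the 4^(j+1) largest coefficients *)

Lemma nneseries_le_ub {R : realType} (u : nat -> \bar R) (b : \bar R) :
  (forall n, 0 <= u n)%E -> (forall n, \sum_(0 <= m < n) u m <= b)%E ->
  (\sum_(0 <= m <oo) u m <= b)%E.
Proof.
by move=> u0 ub; apply: lime_le; [exact: is_cvg_nneseries|exact: nearW].
Qed.

Lemma geometric_sum_le {R : realFieldType} (r : R) n : 0 <= r -> r < 1 ->
  \sum_(0 <= m < n) r ^+ m <= (1 - r)^-1.
Proof.
move=> r0 r1; have r1' : 0 < 1 - r by rewrite subr_gt0.
suff -> : \sum_(0 <= m < n) r ^+ m = (1 - r ^+ n) / (1 - r).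
  by rewrite ler_pdivrMr// mulVf ?gt_eqF// gerBl exprn_ge0.
elim: n => [|n IH]; first by rewrite big_geq// expr0 subrr mul0r.
by rewrite big_nat_recr//= IH exprS; field; rewrite gt_eqF.
Qed.

Section core.
Context {R : realType}.
Notation mu := (@lebesgue_measure R).
Variable f : R -> R[i].
Hypothesis mf : cmeasurable f.

Definition tail_energy (t : R) : \bar R :=
  (\int[mu]_(u in `[t, 1%R]) fun_rearrangement f u ^+ 2)%E.

Lemma quart_itv_sub_unit n j : (j < n)%N -> @quart_itv R j `<=` `[4%:R^-n, 1].
Proof.
move=> jn x; rewrite /quart_itv/= !in_itv/= => /andP[x1 x2]; apply/andP; split.
  apply: le_trans (ltW x1).
  by rewrite lef_pV2 ?posrE ?exprn_gt0// ler_eXn2l// ltr1n.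
by apply: (le_trans (ltW x2)); rewrite invf_le1 ?exprn_gt0// exprn_ege1// ler1n.
Qed.

(** On each interval f^* is at least its value at the right endpoint. A minorant [a] stands in for
    that value, which may still be infinite at this stage. *)
Lemma tail_energy_ge_step n (a : nat -> R) : (forall j, 0 <= a j) ->
  (forall j, (j < n)%N -> ((a j)%:E <= fun_rearrangement f (4%:R^-j))%E) ->
  ((\sum_(j < n) a j ^+ 2 * (3%:R / 4%:R * 4%:R^-j))%:E <= tail_energy (4%:R^-n))%E.
Proof.
move=> a0 af; apply: (@quart_step_le_integral _ `[4%:R^-n, 1] _ n (fun j => a j ^+ 2)).
- exact: measurable_itv.
- by move=> j; rewrite sqr_ge0.
- by move=> x _; rewrite expe2 mule_ge0 ?fun_rearrangement_ge0.
- by move=> j jn; exact: quart_itv_sub_unit.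
move=> j x jn; rewrite /quart_itv/= in_itv/= => /andP[_ xj].
have ax : ((a j)%:E <= fun_rearrangement f x)%E.
  by apply: (le_trans (af j jn)); apply: fun_rearrangement_antitone; exact: ltW.
by rewrite EFin_expe !expe2 lee_pmul// lee_fin.
Qed.

Lemma fun_rearrangement_fin j n (K : R) : (j < n)%N ->
  (tail_energy (4%:R^-n) <= K%:E)%E ->
  fun_rearrangement f (4%:R^-j) \is a fin_num.
Proof.
move=> jn HK; rewrite ge0_fin_numE ?fun_rearrangement_ge0// ltey; apply/eqP => foo.
have K0 : 0 <= K.
  rewrite -lee_fin; apply: le_trans HK; apply: integral_ge0 => x _.
  by rewrite expe2 mule_ge0 ?fun_rearrangement_ge0.
(* A single step, high enough to contribute 3/2 (K + 1) > K to the lower bound. *)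
pose a i : R := if i == j then Num.sqrt (2%:R * 4%:R ^+ j * (K + 1)) else 0.
have a0 i : 0 <= a i by rewrite /a; case: ifP => // _; exact: sqrtr_ge0.
have H : \sum_(i < n) a i ^+ 2 * (3%:R / 4%:R * 4%:R^-i) <= K.
  rewrite -lee_fin; apply: le_trans HK; apply: tail_energy_ge_step => // i _; rewrite /a; case: ifP => [/eqP ->|_]; last exact: fun_rearrangement_ge0.
  by rewrite foo leey.
move: H; apply/negP; rewrite -ltNge (bigD1 (Ordinal jn))//= /a eqxx sqr_sqrtr; last first.
  by rewrite !mulr_ge0// addr_ge0.
rewrite ltr_wpDr//.
  by apply: sumr_ge0 => i _; rewrite mulr_ge0 ?sqr_ge0// mulr_ge0// invr_ge0 exprn_ge0.
have e0 : (4%:R ^+ j : R) != 0 by rewrite expf_neq0.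
have -> : 2 * 4 ^+ j * (K + 1) * (3 / 4 * 4 ^- j) = 3 / 2 * (K + 1).
  by field.
by lra.
Qed.

Context {k : index_kind}.
Variables (phi : sys_index k -> R -> R[i]) (M : R).
Hypothesis phi_orth : orthonormal_system phi.
Hypothesis phi_bound : sup_norm phi = M%:E.

(** The hypothesis on all tails at once yields both an energy bound of order X^2 for the low part
    and an L1 bound of order 2^-(j+p) X for the high part. The latter series converges because the
    rate 3/2 is below 2. *)
Lemma seq_rearrangement_core (j p N : nat) (X : R) : 0 <= X ->
  (N <= 4 ^ j.+1)%N ->
  (forall m, (tail_energy (4%:R^-(j + p + m)) <= (((3%:R / 2%:R) ^+ m * X) ^+ 2)%:E)%E) ->
  (\sum_(1 <= i < N.+1) seq_rearrangement (fourier_coef phi f) i ^+ 2 <=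
   ((290%:R * Num.max 1 (M / 2%:R ^+ p) * X) ^+ 2)%:E)%E.
Proof.
move=> X0 N4 HX; set J := (j + p)%N.
have M1 := sup_norm_ge1 phi_orth phi_bound.
pose L i := fine (fun_rearrangement f (4%:R^-i)).
have Lfin i : (L i)%:E = fun_rearrangement f (4%:R^-i).
  rewrite /L fineK//; apply: (@fun_rearrangement_fin i (J + i.+1)); last exact: HX.
  by rewrite addnS ltnS leq_addl.
have L_ge0 i : 0 <= L i by rewrite -lee_fin Lfin fun_rearrangement_ge0.
have L0 : L 0%N = 0.
  by rewrite /L expr0 invr1 fun_rearrangement1.
have mu_L i : (mu (superlevel f (L i)) <= (4%:R^-i)%:E)%E.
  by apply: mu_superlevel_rearrangement.
have HL m : \sum_(i < J + m) L i ^+ 2 * (3%:R / 4%:R * 4%:R^-i) <= ((3%:R / 2%:R) ^+ m * X) ^+ 2.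
  rewrite -lee_fin; apply: le_trans (HX m); apply: tail_energy_ge_step => // i _.
  by rewrite Lfin.
(* The tail with m = 1 reaches far enough to include L 1, ..., L J. Shifting the index and dividing
   by 3/4 costs 16/3, and 16/3 (3/2)^2 = 12. *)
have HA : \sum_(i < J) L i.+1 ^+ 2 * 4%:R^-i <= 12%:R * X ^+ 2.
  have := HL 1%N; rewrite addn1 big_ord_recl/= L0 expr0n/= mul0r add0r expr1.
  have -> : \sum_(i < J) L i.+1 ^+ 2 * 4%:R^-i =
    16%:R / 3%:R * \sum_(i < J) L (bump 0 i) ^+ 2 * (3 / 4 * 4 ^- bump 0 i).
    rewrite mulr_sumr; apply: eq_bigr => i _; rewrite /bump/= add1n (exprS 4%:R i).
    have e0 : (4%:R ^+ i : R) != 0 by rewrite expf_neq0.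
    by field.
  set S := \sum_(i < J) _; rewrite exprMn; nra.
(* One term of the tail with m + 2 is isolated: 16/3 (3/2)^4 = 27, and 9 generously bounds its
   square root. *)
have HLm m : L (J + m).+1 * 4%:R^-(J + m) <= 9%:R * 2%:R^-J * X * (3%:R / 4%:R) ^+ m.
  have iJ : ((J + m).+1 < J + m.+2)%N by rewrite !addnS.
  have := HL m.+2; rewrite (bigD1 (Ordinal iJ))//=.
  set S := \sum_(i < _ | _) _ => H.
  have S0 : 0 <= S.
    by apply: sumr_ge0 => i _; rewrite mulr_ge0 ?sqr_ge0// mulr_ge0// invr_ge0 exprn_ge0.
  have e2 : 0 < (2%:R ^+ (J + m) : R) by rewrite exprn_gt0.
  have e4 : (4%:R ^+ (J + m) : R) = (2%:R ^+ (J + m)) ^+ 2.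
    by rewrite -exprM mulnC exprM; congr (_ ^+ _); rewrite expr2 -natrM.
  have H2 : (L (J + m).+1 / 2%:R ^+ (J + m)) ^+ 2 <= (9%:R * (3%:R / 2%:R) ^+ m * X) ^+ 2.
    have -> : (L (J + m).+1 / 2%:R ^+ (J + m)) ^+ 2 =
        16%:R / 3%:R * (L (J + m).+1 ^+ 2 * (3%:R / 4%:R * 4%:R^-(J + m).+1)).
      by rewrite (exprS 4%:R) e4; field; rewrite gt_eqF.
    have E : ((3 / 2) ^+ m.+2 * X) ^+ 2 = 81%:R / 16%:R * ((3%:R / 2%:R) ^+ m * X) ^+ 2 :> R.
      by rewrite !exprS; field.
    rewrite E in H; rewrite -mulrA exprMn.
    have := sqr_ge0 ((3%:R / 2%:R) ^+ m * X : R); nra.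
  have {}H2 : L (J + m).+1 / 2%:R ^+ (J + m) <= 9%:R * (3%:R / 2%:R) ^+ m * X.
    rewrite -(@ler_pXn2r _ 2)// nnegrE.
      by rewrite mulr_ge0// invr_ge0 ltW.
    by rewrite !mulr_ge0// exprn_ge0.
  have -> : L (J + m).+1 * 4%:R^-(J + m) =
     L (J + m).+1 / 2%:R ^+ (J + m) * 2%:R^-(J + m).
    by rewrite e4 expr2 invfM mulrA.
  apply: (@le_trans _ _ (9%:R * (3%:R / 2%:R) ^+ m * X * 2%:R^-(J + m))).
    by rewrite ler_wpM2r// invr_ge0 ltW.
  have -> : (3%:R / 4%:R : R) ^+ m = (3%:R / 2%:R) ^+ m * 2%:R^-m.
    by rewrite -exprVn -exprMn; congr (_ ^+ _); field.
  rewrite exprD invfM le_eqVlt; apply/orP; left; apply/eqP.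
  by set a := (_ / _) ^+ m; set b := _^-1; set c := _^-1; ring.
(* 36 = 9 * 4, where 4 is the sum of the geometric series of ratio 3/4. *)
pose B : R := 36%:R * 2%:R^-J * X.
have HB : (\sum_(0 <= m <oo) (L (J + m).+1 * 4%:R^-(J + m))%:E <= B%:E)%E.
  apply: nneseries_le_ub => n.
    by rewrite lee_fin mulr_ge0// invr_ge0 exprn_ge0.
  rewrite sumEFin lee_fin.
  apply: (@le_trans _ _ (\sum_(0 <= m < n) 9%:R * 2%:R^-J * X * (3%:R / 4%:R) ^+ m)).
    by apply: ler_sum => m _.
  rewrite -mulr_sumr /B.
  have := @geometric_sum_le R (3%:R / 4%:R) n.
  have -> : (1 - 3%:R / 4%:R : R)^-1 = 4%:R by field.
  set S := \sum_(_ <= _ < _) _ => HS.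
  have {}HS : S <= 4%:R by apply: HS; lra.
  have -> : 36%:R * 2%:R^-J * X = 9%:R * 2%:R^-J * X * 4%:R by ring.
  by rewrite ler_wpM2l// !mulr_ge0// invr_ge0 exprn_ge0.
set mx := Num.max _ _.
have mx1 : 1 <= mx by rewrite /mx le_max lexx.
have mxM : M / 2%:R ^+ p <= mx by rewrite /mx le_max lexx orbT.
apply: (@le_trans _ _ (2%:R * (2%:R * (12%:R * X ^+ 2) + 8%:R * N%:R * (M * B) ^+ 2))%:E).
  apply: seq_rearrangement_sum_le.
    apply: addr_ge0; apply: mulr_ge0 => //; last exact: sqr_ge0.
    by apply: mulr_ge0 => //; exact: sqr_ge0.
  move=> s us sN.
  apply: (le_trans (fourier_coef_sum_le phi_orth phi_bound mf L0 L_ge0 mu_L HA HB us)).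
  rewrite lerD2l ler_wpM2r ?sqr_ge0// ler_wpM2l// ler_nat.
  exact: sN.
rewrite lee_fin.
have e2j : 0 < (2%:R ^+ j : R) by rewrite exprn_gt0.
have e2p : 0 < (2%:R ^+ p : R) by rewrite exprn_gt0.
have NE : N%:R <= 4%:R * (2%:R ^+ j) ^+ 2 :> R.
  rewrite -exprM mulnC exprM -!natrX -natrM ler_nat.
  by apply: (leq_trans N4); rewrite expnS.
(* Since 2^J = 2^j 2^p, the number of coefficients, whose square root is at most 2 * 2^j, cancels
   the factor 2^-j of [B], and only M / 2^p survives. *)
have BE : M * B * 2%:R ^+ j = 36%:R * (M / 2%:R ^+ p) * X.
  by rewrite /B /J exprD; field; rewrite !gt_eqF.
have H1 : N%:R * (M * B) ^+ 2 <= 4%:R * (36%:R * (M / 2%:R ^+ p) * X) ^+ 2.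
  by rewrite -BE (exprMn _ (M * B)) [leRHS]mulrCA [leLHS]mulrC ler_wpM2l ?sqr_ge0.
have mx0 : 0 <= mx by exact: le_trans ler01 mx1.
have H2 : (M / 2%:R ^+ p * X) ^+ 2 <= (mx * X) ^+ 2.
  have m0 : 0 <= M / 2%:R ^+ p.
    by apply: divr_ge0; [exact: le_trans ler01 M1|exact: ltW].
  by rewrite ler_sqr; [exact: ler_wpM2r| |]; rewrite nnegrE; exact: mulr_ge0.
have H3 : X ^+ 2 <= (mx * X) ^+ 2.
  by rewrite ler_sqr; [exact: ler_peMl| |]; rewrite nnegrE//; exact: mulr_ge0.
(* The total is 48 + 16 * 5184 = 82992, and 290^2 = 84100 is above it. *)
have -> : (290%:R * mx * X) ^+ 2 = 84100%:R * (mx * X) ^+ 2 by ring.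
have {}H1 : N%:R * (M * B) ^+ 2 <= 5184%:R * (M / 2%:R ^+ p * X) ^+ 2.
  apply: (le_trans H1); rewrite le_eqVlt; apply/orP; left; apply/eqP.
  by set y := M / _; ring.
move: H1 H2 H3; rewrite -(mulrA 8%:R); set u := N%:R * _; set v := (_ * X) ^+ 2; set w := (_ * X) ^+ 2.
by have := sqr_ge0 X; move=> ? ? ? ?; lra.
Qed.

End core.

(** * Powers against geometric growth, and logarithmic weights *)

Section growth.
Context {R : realType}.
Implicit Types (x r b : R).

(** Write r = s^2. Of the two factors s^m, one pays for a linear factor 1 + m by Bernoulli's
    inequality, the other for the remaining power by induction. *)
Lemma natpow_le_geometric n r : 1 < r ->
  exists2 K : R, 0 < K & forall m : nat, (1 + m%:R) ^+ n <= K * r ^+ m.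
Proof.
elim: n r => [|n IH] r r1.
  by exists 1 => // m; rewrite expr0 mul1r exprn_ege1// ltW.
have r0 : 0 <= r by lra.
pose s := Num.sqrt r.
have sr : s ^+ 2 = r by rewrite sqr_sqrtr.
have s1 : 1 < s by rewrite -[ltLHS]sqrtr1 ltr_sqrt//; lra.
have [K K0 HK] := IH s s1.
have d0 : 0 < s - 1 by rewrite subr_gt0.
have bern m : 1 + m%:R * (s - 1) <= s ^+ m.
  elim: m => [|m IHm]; first by rewrite mul0r addr0 expr0.
  rewrite exprS -natr1.
  have : s * (1 + m%:R * (s - 1)) <= s * s ^+ m by rewrite ler_wpM2l// ltW// (lt_trans _ s1).
  apply: le_trans; have := ler0n R m.
  have := mulr_ge0 (ler0n R m) (sqr_ge0 (s - 1)); nra.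
exists (K * (1 + (s - 1)^-1)); first by rewrite mulr_gt0// addr_gt0// invr_gt0.
move=> m; rewrite exprS -sr -exprM mulnC exprM expr2.
have lin : 1 + m%:R <= (1 + (s - 1)^-1) * s ^+ m.
  have i0 : 0 < (s - 1)^-1 by rewrite invr_gt0.
  apply: (@le_trans _ _ ((1 + (s - 1)^-1) * (1 + m%:R * (s - 1)))); last first.
    by rewrite ler_wpM2l// addr_ge0// ltW.
  have -> : (1 + (s - 1)^-1) * (1 + m%:R * (s - 1)) =
    1 + m%:R + m%:R * (s - 1) + (s - 1)^-1 by field; rewrite gt_eqF.
  have := mulr_ge0 (ler0n R m) (ltW d0); lra.
have -> : K * (1 + (s - 1)^-1) * (s ^+ m * s ^+ m) =
  (1 + (s - 1)^-1) * s ^+ m * (K * s ^+ m) by ring.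
by apply: ler_pM.
Qed.

Lemma powR_le_geometric b r : 1 < r ->
  exists2 K : R, 0 < K & forall m : nat, (1 + m%:R) `^ b <= K * r ^+ m.
Proof.
move=> r1; have [K K0 HK] := natpow_le_geometric (Num.truncn b).+1 r1.
exists K => // m; apply: le_trans (HK m).
rewrite -powR_mulrn ?addr_ge0//; apply: ler_powR; first by rewrite lerDl.
exact/ltW/truncnS_gt.
Qed.

Lemma ln2_ge : 2%:R^-1 <= ln (2%:R : R).
Proof.
have := @le_ln1Dx R (2%:R^-1 - 1); rewrite [1 + _]addrC subrK lnV ?posrE//.
have : -1 < 2%:R^-1 - 1 :> R by lra.
by move=> h /(_ h); lra.
Qed.

Lemma ln4E : ln (4%:R : R) = 2%:R * ln 2%:R.
Proof.
by rewrite (_ : 4%:R = 2%:R ^+ 2 :> R) ?lnXn// ?mulr_natl// expr2 -natrM.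
Qed.

Lemma ln4_ge1 : 1 <= ln (4%:R : R).
Proof. rewrite ln4E; have := ln2_ge; lra. Qed.

Lemma ln4_le2 : ln (4%:R : R) <= 2%:R.
Proof.
rewrite ln4E; have := @le_ln1Dx R 1; rewrite (_ : 1 + 1 = 2%:R :> R) //.
have : -1 < 1 :> R by lra.
by move=> h /(_ h); lra.
Qed.

Lemma powR_npos_antitone (alpha x y : R) : alpha <= 0 -> 0 < x -> x <= y ->
  y `^ alpha <= x `^ alpha.
Proof.
move=> a0 x0 xy; have y0 := lt_le_trans x0 xy.
have le : x `^ (- alpha) <= y `^ (- alpha).
  by apply: ge0_ler_powR; rewrite ?oppr_ge0 ?nnegrE ?(ltW x0) ?(ltW y0).
by rewrite -[alpha]opprK !(powRN _ (- alpha)) lef_pV2// posrE powR_gt0.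
Qed.

Lemma ln_expr4 j : ln (4%:R ^+ j : R) = j%:R * ln 4%:R.
Proof. by rewrite lnXn// mulr_natl. Qed.

Lemma log_weight_nat (alpha : R) (N j : nat) : alpha <= 0 -> (4 ^ j <= N)%N ->
  log_weight alpha N%:R <= (1 + j%:R) `^ alpha.
Proof.
move=> a0 jN; apply: powR_npos_antitone => //.
rewrite lerD2l; apply: le_trans (ler_norm _).
apply: (@le_trans _ _ (ln (4%:R ^+ j : R))).
  by rewrite ln_expr4 ler_peMr// ln4_ge1.
rewrite ler_ln ?posrE ?exprn_gt0//; first by rewrite -natrX ler_nat.
by rewrite ltr0n (leq_trans _ jN)// expn_gt0.
Qed.

(** The factor 3 comes from 1 + |ln t| <= 1 + (j + 1) ln 4 <= 3 + 2 j. *)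
Lemma log_weight_quart_itv (alpha t : R) (j : nat) : alpha <= 0 -> quart_itv j t ->
  (3%:R * (1 + j%:R)) `^ alpha <= log_weight alpha t.
Proof.
move=> a0; rewrite /quart_itv/= in_itv/= => /andP[t1 t2].
have t0 : 0 < t by apply: lt_trans t1; rewrite invr_gt0 exprn_gt0.
apply: powR_npos_antitone => //.
rewrite ler0_norm; last first.
  apply: ln_le0; apply: (le_trans (ltW t2)).
  by rewrite invf_le1 ?exprn_gt0// exprn_ege1// ler1n.
rewrite -lnV ?posrE//.
have : ln t^-1 <= ln (4%:R ^+ j.+1).
  rewrite ler_ln ?posrE ?invr_gt0 ?exprn_gt0//.
  by rewrite -[leRHS]invrK lef_pV2 ?posrE ?invr_gt0 ?exprn_gt0// ltW.
rewrite ln_expr4 -natr1; have := ln4_le2; have := ler0n R j; nra.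
Qed.

(* Take the least [p] with M <= 2^p. *)
Lemma dyadic_exponent (M beta : R) : 0 <= beta -> 1 <= M ->
  exists p : nat, Num.max 1 (M / 2%:R ^+ p) * (1 + p%:R) `^ beta <=
    2%:R `^ beta * (1 + ln M) `^ beta.
Proof.
move=> b0 M1.
have Mp : exists p : nat, M <= 2%:R ^+ p.
  exists (Num.truncn M).+1; apply: (le_trans (ltW (truncnS_gt M))).
  by rewrite -natrX ler_nat ltnW// ltn_expl.
have [p Mp' minp] := ex_minnP Mp.
exists p; rewrite max_l; last by rewrite ler_pdivrMr ?exprn_gt0// mul1r.
have lM := ln_ge0 M1.
have lM1 : 0 <= 1 + ln M by lra.
rewrite mul1r -powRM//; apply: ge0_ler_powR; rewrite ?nnegrE ?mulr_ge0//.
case: p Mp' minp => [|p] _ minp; first by lra.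
(* Minimality of p + 1 gives p ln 2 <= ln M, hence p <= 2 ln M and 1 + (p + 1) <= 2 (1 + ln M). *)
have pM : 2%:R ^+ p < M by rewrite ltNge; apply/negP => /minp; rewrite ltnn.
have : ln (2%:R ^+ p) <= ln M.
  by rewrite ler_ln ?posrE ?exprn_gt0 ?ltW//; exact: lt_le_trans ltr01 M1.
rewrite lnXn// -[_ *+ p]mulr_natl -natr1; have := ln2_ge; have := ler0n R p; nra.
Qed.

End growth.

(** * The weighted estimate on one block of indices *)

Section blocks.
Context {R : realType}.
Variables (f : R -> R[i]) (k : index_kind) (phi : sys_index k -> R -> R[i]) (M : R).
Variables (alpha K : R).
Hypothesis mf : cmeasurable f.
Hypothesis phi_orth : orthonormal_system phi.
Hypothesis phi_bound : sup_norm phi = M%:E.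
Hypothesis alpha_le0 : alpha <= 0.
Hypothesis K_gt0 : 0 < K.
Hypothesis K_growth : forall m : nat, (1 + m%:R) `^ (- alpha) <= K * (5%:R / 4%:R) ^+ m.

Definition seq_profile (N : nat) : \bar R :=
  ((log_weight alpha N%:R)%:E * (\sum_(1 <= i < N.+1)
    seq_rearrangement (fourier_coef phi f) i ^+ 2) `^ 2^-1)%E.

(** By 1 + j + p + m <= (1 + j)(1 + p)(1 + m) the weight splits into three factors: the one in j is
    cancelled by the logarithmic weight at N >= 4^j, the one in p is the price of the shift, and the
    one in m is at most K (5/4)^m. With (6/5)^m this makes the rate 3/2. *)
Lemma seq_profile_block (j p N : nat) (Y : R) : 0 <= Y ->
  (4 ^ j <= N <= 4 ^ j.+1)%N ->
  (forall m, (tail_energy f (4%:R^-(j + p + m)) <=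
    (((1 + (j + p + m)%:R) `^ (- alpha) * (6%:R / 5%:R) ^+ m * Y) ^+ 2)%:E)%E) ->
  (seq_profile N <=
   (290%:R * K * (Num.max 1 (M / 2%:R ^+ p) * (1 + p%:R) `^ (- alpha)) * Y)%:E)%E.
Proof.
move=> Y0 /andP[jN Nj] HY.
pose w := (1 + j%:R : R) `^ (- alpha).
pose v := (1 + p%:R : R) `^ (- alpha).
have w0 : 0 < w by rewrite powR_gt0// ltr_pwDl.
have v0 : 0 < v by rewrite powR_gt0// ltr_pwDl.
pose X := K * w * v * Y.
have X0 : 0 <= X by rewrite !mulr_ge0// ltW.
have HX m : (tail_energy f (4%:R^-(j + p + m)) <= (((3%:R / 2%:R) ^+ m * X) ^+ 2)%:E)%E.
  apply: le_trans (HY m) _; rewrite lee_fin ler_sqr; last 2 first.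
  - by rewrite nnegrE !mulr_ge0 ?powR_ge0// exprn_ge0.
  - by rewrite nnegrE mulr_ge0// exprn_ge0.
  have u1 : (1 + (j + p + m)%:R : R) `^ (- alpha) <= w * v * (1 + m%:R) `^ (- alpha).
    rewrite /w /v -!powRM ?mulr_ge0 ?addr_ge0//.
    apply: ge0_ler_powR; rewrite ?oppr_ge0// ?nnegrE ?mulr_ge0 ?addr_ge0//.
    rewrite !natrD; have := ler0n R j; have := ler0n R p; have := ler0n R m.
    set a := j%:R; set b := p%:R; set c := m%:R => c0 b0 a0.
    have := mulr_ge0 a0 b0; have := mulr_ge0 a0 c0; have := mulr_ge0 b0 c0.
    have := mulr_ge0 (mulr_ge0 a0 b0) c0; lra.
  apply: (@le_trans _ _ (w * v * (K * (5%:R / 4%:R) ^+ m) * (6%:R / 5%:R) ^+ m * Y)).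
    rewrite ler_wpM2r// ler_wpM2r ?exprn_ge0//; apply: (le_trans u1).
    by rewrite ler_wpM2l// mulr_ge0// ltW.
  have -> : (3%:R / 2%:R : R) ^+ m = (5%:R / 4%:R) ^+ m * (6%:R / 5%:R) ^+ m.
    by rewrite -exprMn; congr (_ ^+ _); field.
  rewrite /X le_eqVlt; apply/orP; left; apply/eqP.
  by set a := _ ^+ m; set b := _ ^+ m; ring.
have core := seq_rearrangement_core mf phi_orth phi_bound X0 Nj HX.
rewrite /seq_profile.
apply: (@le_trans _ _ ((w^-1)%:E * (290%:R * Num.max 1 (M / 2%:R ^+ p) * X)%:E)%E).
  have S0 : (0 <= \sum_(1 <= i < N.+1) seq_rearrangement (fourier_coef phi f) i ^+ 2)%E.
    by apply: sume_ge0 => i _; rewrite expe2 mule_ge0 ?seq_rearrangement_ge0.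
  have Z0 : 0 <= 290%:R * Num.max 1 (M / 2%:R ^+ p) * X.
    by rewrite mulr_ge0// mulr_ge0// le_max ler01.
  apply: lee_pmul; rewrite ?lee_fin ?powR_ge0 ?poweR_ge0//.
    by rewrite /w powRN invrK log_weight_nat.
  set Z := 290%:R * _ * X in core Z0 *.
  have -> : Z%:E = ((Z ^+ 2)%:E `^ 2^-1)%E.
    by rewrite poweR_EFin powR12_sqrt ?sqr_ge0// sqrtr_sqr ger0_norm.
  by apply: gt0_ler_poweR; rewrite ?in_itv/= ?leey ?andbT ?lee_fin ?sqr_ge0.
rewrite -EFinM lee_fin /X -/v le_eqVlt; apply/orP; left; apply/eqP.
by set mx := Num.max _ _; field; rewrite gt_eqF.
Qed.

End blocks.

(** * Majorants in l^r and sums over blocks *)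

Section real_sums.
Context {R : realType}.

(** The majorant is Y_j = (sum_m (5/6)^(m r) a_(j+p+m)^r)^(1/r). Each of its terms gives the
    pointwise bound; exchanging the two sums gives the last one, a shift of indices only dropping
    terms of the sum of a_i^r. As no triangle inequality in l^r occurs, r < 1 is covered too. *)
Lemma tail_majorant (r V : R) (a : nat -> R) (p : nat) : 0 < r ->
  (forall i, 0 <= a i) -> (forall n, \sum_(0 <= i < n) a i `^ r <= V) ->
  exists Y : nat -> R, [/\ forall j, 0 <= Y j,
    forall j m, a (j + p + m)%N <= (6%:R / 5%:R) ^+ m * Y j &
    forall n, \sum_(0 <= j < n) Y j `^ r <= V * (1 - (5%:R / 6%:R) `^ r)^-1].
Proof.
move=> r0 a0 HV.
have V0 : 0 <= V by have := HV 0%N; rewrite big_geq.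
set q := (5%:R / 6%:R) `^ r.
have q0 : 0 <= q by exact: powR_ge0.
have q1 : q < 1.
  have := @gt0_ltr_powR R r r0 (5%:R / 6%:R) 1; rewrite powR1 !nnegrE; apply => //; lra.
have aV i : a i `^ r <= V.
  apply: le_trans (HV i.+1); rewrite big_nat_recr//= lerDr.
  by apply: sumr_ge0 => j _; exact: powR_ge0.
pose s j m := (q ^+ m * a (j + p + m)%N `^ r)%:E.
have s0 j m : (0 <= s j m)%E by rewrite lee_fin mulr_ge0 ?exprn_ge0 ?powR_ge0.
pose y j := (\sum_(0 <= m <oo) s j m)%E.
have y0 j : (0 <= y j)%E by exact: nneseries_ge0.
have Hy n : (\sum_(0 <= j < n) y j <= (V * (1 - q)^-1)%:E)%E.
  rewrite /y -nneseries_sum_nat//.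
  apply: nneseries_le_ub => [m|n']; first exact: sume_ge0.
  apply: (@le_trans _ _ (\sum_(0 <= m < n') (V * q ^+ m)%:E)%E).
    apply: lee_sum => m _; rewrite sumEFin lee_fin -mulr_sumr mulrC.
    rewrite ler_wpM2r ?exprn_ge0//.
    apply: le_trans (HV (n + (p + m))%N).
    rewrite [leRHS](big_cat_nat (leq0n (p + m)) (leq_addl n (p + m)))/=.
    rewrite -[leLHS]add0r; apply: lerD; first by apply: sumr_ge0 => i _; exact: powR_ge0.
    rewrite -{1}(add0n (p + m)%N) big_addn addnK.
    by rewrite le_eqVlt; apply/orP; left; apply/eqP; apply: eq_bigr => i _; rewrite addnA.
  rewrite sumEFin lee_fin -mulr_sumr ler_wpM2l//.
  exact: geometric_sum_le.
have yfin j : y j \is a fin_num.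
  rewrite ge0_fin_numE//; apply: le_lt_trans (ltry (V * (1 - q)^-1)).
  apply: le_trans (Hy j.+1); rewrite big_nat_recr//= leeDr//.
  exact: sume_ge0.
pose Y j := fine (y j) `^ r^-1.
have YE j : Y j `^ r = fine (y j).
  by rewrite /Y -powRrM mulVf ?gt_eqF// powRr1// fine_ge0.
exists Y; split => [j|j m|n].
- exact: powR_ge0.
- have : ((s j m) <= y j)%E.
    rewrite /y (nneseries_split 0 m.+1)// big_mkord big_ord_recr/=.
    rewrite -[leLHS]add0e -[leLHS]adde0.
    apply: leeD; last exact: nneseries_ge0.
    by apply: leeD => //; exact: sume_ge0.
  rewrite -(fineK (yfin j)) -YE lee_fin => H.
  rewrite -ler_pdivrMl ?exprn_gt0 ?divr_gt0// -exprVn invf_div.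
  have -> : (5%:R / 6%:R) ^+ m * a (j + p + m)%N = (q ^+ m * a (j + p + m)%N `^ r) `^ r^-1.
    rewrite powRM ?exprn_ge0 ?powR_ge0// -[X in _ = _ * X]powRrM mulfV ?gt_eqF// powRr1//.
    rewrite /q -[X in X `^ r^-1]powR_mulrn ?powR_ge0// -!powRrM mulrCA mulfV ?gt_eqF// mulr1 powR_mulrn//.
  have -> : Y j = (Y j `^ r) `^ r^-1.
    by rewrite -powRrM mulfV ?gt_eqF// powRr1// powR_ge0.
  by apply: ge0_ler_powR; rewrite ?nnegrE ?mulr_ge0 ?exprn_ge0 ?powR_ge0 ?invr_ge0 ?(ltW r0).
- rewrite -lee_fin -sumEFin; apply: le_trans (Hy n).
  by apply: lee_sum => j _; rewrite YE fineK.
Qed.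

(** A block has 3 * 4^j indices, each with 1/i <= 4^-j. *)
Lemma dyadic_block_sum (u : nat -> \bar R) (z : nat -> R) n :
  (forall j, 0 <= z j) -> (forall i, 0 <= u i)%E ->
  (forall j i, (4 ^ j <= i < 4 ^ j.+1)%N -> (u i <= (z j)%:E)%E) ->
  (\sum_(1 <= i < 4 ^ n) u i * (i%:R^-1)%:E <= (3%:R * \sum_(0 <= j < n) z j)%:E)%E.
Proof.
move=> z0 u0 uz; elim: n => [|n IH].
  by rewrite !big_geq ?mulr0.
have n1 : (1 <= 4 ^ n)%N by rewrite expn_gt0.
have n2 : (4 ^ n <= 4 ^ n.+1)%N by rewrite leq_exp2l.
rewrite (big_cat_nat n1 n2)/=.
rewrite big_nat_recr//= mulrDr EFinD; apply: leeD => //.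
have e0 : 0 < (4%:R ^+ n : R) by rewrite exprn_gt0.
apply: (@le_trans _ _ (\sum_(4 ^ n <= i < 4 ^ n.+1) (z n * 4%:R^-n)%:E)%E).
  rewrite big_nat_cond [leRHS]big_nat_cond; apply: lee_sum => i /andP[/andP[i1 i2] _].
  rewrite EFinM; apply: lee_pmul; rewrite ?lee_fin ?invr_ge0//; first by rewrite uz// i1.
  rewrite lef_pV2 ?posrE//; first by rewrite -natrX ler_nat.
  by rewrite ltr0n (leq_trans _ i1)// expn_gt0.
rewrite sumEFin lee_fin sumr_const_nat.
have -> : (4 ^ n.+1 - 4 ^ n = 3 * 4 ^ n)%N by rewrite expnS; lia.
rewrite -[_ *+ _]mulr_natl natrM natrX le_eqVlt; apply/orP; left; apply/eqP.
by field; rewrite gt_eqF.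
Qed.

End real_sums.

(** * Tail energies and the function quasinorm *)

Section function_side.
Context {R : realType}.
Notation mu := (@lebesgue_measure R).
Variables (f : R -> R[i]) (alpha : R).
Hypothesis alpha_le0 : alpha <= 0.

Lemma tail_energy_ge0 t : (0 <= tail_energy f t)%E.
Proof. by apply: integral_ge0 => x _; rewrite expe2 mule_ge0 ?fun_rearrangement_ge0. Qed.

Lemma tail_energy_antitone s t : s <= t -> (tail_energy f t <= tail_energy f s)%E.
Proof.
move=> st; rewrite /tail_energy [leLHS]integral_mkcond [leRHS]integral_mkcond.
have f0 x : (0 <= fun_rearrangement f x ^+ 2)%E by rewrite expe2 mule_ge0 ?fun_rearrangement_ge0.
apply: ge0_le_integral_nomeas => x _; rewrite /patch; first by case: ifP.
case: ifPn => [|_]; last by case: ifP.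
rewrite inE/= in_itv/= => /andP[tx x1].
by rewrite ifT// inE/= in_itv/= x1 (le_trans st).
Qed.

(** Convertible to the local [F] of [fun_quasinorm], as [seq_profile] is to that of [seq_quasinorm];
    the final estimates rely on this. *)
Definition fun_profile (t : R) : \bar R :=
  ((log_weight alpha t)%:E * tail_energy f t `^ 2^-1)%E.

Lemma fun_profile_ge0 t : (0 <= fun_profile t)%E.
Proof. by rewrite mule_ge0 ?poweR_ge0// lee_fin powR_ge0. Qed.

Lemma fun_profile_ge j t : quart_itv j t ->
  (((3%:R * (1 + j%:R)) `^ alpha)%:E * tail_energy f (4%:R^-j) `^ 2^-1 <=
    fun_profile t)%E.
Proof.
move=> tj; apply: lee_pmul; rewrite ?poweR_ge0 ?lee_fin ?powR_ge0//.
  exact: log_weight_quart_itv.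
apply: gt0_ler_poweR; rewrite ?in_itv/= ?tail_energy_ge0 ?leey//.
apply: tail_energy_antitone; move: tj; rewrite /quart_itv/= in_itv/= => /andP[_ /ltW].
by [].
Qed.

Lemma sqr_le_of_weighted_sqrt (T : \bar R) (c Q : R) : 0 < c -> (0 <= T)%E ->
  (c%:E * T `^ 2^-1 <= Q%:E)%E -> (T <= ((c^-1 * Q) ^+ 2)%:E)%E.
Proof.
move=> c0; case: T => [T| |]//.
  rewrite lee_fin => T0; rewrite poweR_EFin -EFinM !lee_fin powR12_sqrt// => H.
  have s0 := sqrtr_ge0 T.
  have Q0 : 0 <= Q by apply: le_trans H; rewrite mulr_ge0// ltW.
  rewrite -{1}(sqr_sqrtr T0) ler_sqr; first by rewrite ler_pdivlMl.
    by [].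
  by rewrite nnegrE mulr_ge0// invr_ge0 ltW.
by move=> _; rewrite poweRyr// gt0_muley ?lte_fin.
Qed.

End function_side.

(** * The inequality for a fixed shift p, for q infinite and q finite *)

Section quasinorm_bounds.
Context {R : realType}.
Notation mu := (@lebesgue_measure R).
Variables (alpha K : R).
Hypothesis alpha_le0 : alpha <= 0.
Hypothesis K_gt0 : 0 < K.
Hypothesis K_growth : forall m : nat, (1 + m%:R) `^ (- alpha) <= K * (5%:R / 4%:R) ^+ m.

Variables (k : index_kind) (phi : sys_index k -> R -> R[i]) (M : R) (f : R -> R[i]).
Hypothesis phi_orth : orthonormal_system phi.
Hypothesis phi_bound : sup_norm phi = M%:E.
Hypothesis mf : cmeasurable f.

(* The constant obtained by cutting [f] at f^*(t) with t = 4^-(j + p) to estimate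
   the 4^j largest coefficients; p = 0 gives M, and 2^p ~ M gives (1 + ln M)^|alpha|. *)
Definition growth_factor (p : nat) : R :=
  Num.max 1 (M / 2%:R ^+ p) * (1 + p%:R) `^ (- alpha).

Lemma growth_factor_ge0 p : 0 <= growth_factor p.
Proof. by rewrite mulr_ge0 ?powR_ge0// le_max ler01. Qed.

Lemma block_index (N : nat) : (1 <= N)%N -> exists j, (4 ^ j <= N < 4 ^ j.+1)%N.
Proof. by move=> N1; exists (trunc_log 4 N); exact: trunc_log_bounds. Qed.

Lemma seq_quasinorm_le_oo (p : nat) :
  (fun_quasinorm +oo alpha (fun_rearrangement f) < +oo)%E ->
  (seq_quasinorm +oo alpha (seq_rearrangement (fourier_coef phi f)) <=
   (290%:R * K * 3%:R `^ (- alpha) * growth_factor p)%:E *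
   fun_quasinorm +oo alpha (fun_rearrangement f))%E.
Proof.
set S := fun_quasinorm _ _ _ => Soo.
have HS t : t \in `]0, 1[ -> (fun_profile f alpha t <= S)%E.
  by move=> t01; apply: ereal_sup_ubound; exists t.
(* The supremum controls the profile everywhere, so one sample point in each interval is enough. *)
have mid j : quart_itv j (4%:R^-j / 2%:R : R).
  rewrite /quart_itv/= in_itv/= exprS invfM.
  have : 0 < 4%:R^-j :> R by rewrite invr_gt0 exprn_gt0.
  by move=> e; apply/andP; split; lra.
have mid01 j : (4%:R^-j / 2%:R : R) \in `]0, 1[.
  have e0 : 0 < 4%:R^-j :> R by rewrite invr_gt0 exprn_gt0.
  have e1 : 4%:R^-j <= 1 :> R by rewrite invf_le1 ?exprn_gt0// exprn_ege1// ler1n.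
  by rewrite in_itv/=; apply/andP; split; lra.
have S0 : (0 <= S)%E by apply: le_trans (HS _ (mid01 0%N)); exact: fun_profile_ge0.
have Sfin : S \is a fin_num by rewrite ge0_fin_numE.
(* The same majorant serves all blocks; 3^|alpha| is the loss of [log_weight_quart_itv]. *)
pose Y := 3%:R `^ (- alpha) * fine S.
have Y0 : 0 <= Y by rewrite mulr_ge0 ?powR_ge0// fine_ge0.
have HY j m : (tail_energy f (4%:R^-(j + p + m)) <=
    (((1 + (j + p + m)%:R) `^ (- alpha) * (6%:R / 5%:R) ^+ m * Y) ^+ 2)%:E)%E.
  set i := (j + p + m)%N; set c := (3%:R * (1 + i%:R)) `^ alpha : R.
  have c0 : 0 < c by rewrite powR_gt0// mulr_gt0// ltr_pwDl.
  apply: (@le_trans _ _ ((c^-1 * fine S) ^+ 2)%:E).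
    apply: sqr_le_of_weighted_sqrt => //; first exact: tail_energy_ge0.
    rewrite fineK//; apply: le_trans (HS _ (mid01 i)).
    by apply: fun_profile_ge.
  have -> : c^-1 = (1 + i%:R) `^ (- alpha) * 3%:R `^ (- alpha).
    by rewrite /c -powRN mulrC -powRM.
  have S0' : 0 <= fine S by exact: fine_ge0.
  rewrite lee_fin ler_sqr ?nnegrE ?mulr_ge0 ?powR_ge0 ?exprn_ge0//.
  rewrite -mulrA -/Y -mulrA ler_wpM2l ?powR_ge0// ler_peMl//.
  by rewrite exprn_ege1//; lra.
apply: ge_ereal_sup => _ [N N1 <-].
have [j /andP[jN Nj]] := block_index N1.
apply: (@le_trans _ _ (290%:R * K * growth_factor p * Y)%:E).
  apply: (seq_profile_block mf phi_orth phi_bound alpha_le0 K_gt0 K_growth Y0 _ (HY j)).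
  by rewrite jN ltnW.
by rewrite -[in leRHS](fineK Sfin) -EFinM lee_fin /Y le_eqVlt; apply/orP; left; apply/eqP; ring.
Qed.

Section finite_exponent.
Variable r : R.
Hypothesis r_gt0 : 0 < r.

Definition geometric_const : R := (1 - (5%:R / 6%:R) `^ r)^-1.

(** 290 K comes from one block; 4 is the 3 of [dyadic_block_sum] times the 4/3 of
    [profile_step_sum_le], which also gives the power of 3; [geometric_const] comes from
    [tail_majorant]. *)
Definition finite_exponent_const : R :=
  290%:R * K * (4%:R * 3%:R `^ (- alpha * r) * geometric_const) `^ r^-1.

Lemma geometric_const_gt0 : 0 < geometric_const.
Proof.
rewrite invr_gt0 subr_gt0.
by have := @gt0_ltr_powR R r r_gt0 (5%:R / 6%:R) 1; rewrite powR1 !nnegrE; apply => //; lra.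
Qed.

(** On each interval 1/t >= 4^i cancels the length 3/4 * 4^-i, so the integral against dt/t becomes
    an unweighted sum. The minorant [c] allows tail energies not yet known to be finite. *)
Lemma profile_step_sum_le (V : R) (c : nat -> R) n :
  (\int[mu]_(t in `]0%R, 1%R[) (fun_profile f alpha t `^ r * (t^-1)%:E) <= V%:E)%E ->
  (forall i, 0 <= c i) ->
  (forall i, (i < n)%N -> ((c i)%:E <= tail_energy f (4%:R^-i) `^ 2^-1)%E) ->
  \sum_(i < n) ((1 + i%:R) `^ alpha * c i) `^ r <=
    4%:R / 3%:R * 3%:R `^ (- alpha * r) * V.
Proof.
move=> HV c0 Hc.
pose a i := 4%:R ^+ i * ((3%:R * (1 + i%:R)) `^ alpha * c i) `^ r.
have a0 i : 0 <= a i by rewrite mulr_ge0 ?exprn_ge0 ?powR_ge0.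
have : \sum_(i < n) a i * (3%:R / 4%:R * 4%:R^-i) <= V.
  rewrite -lee_fin; apply: le_trans HV; apply: quart_step_le_integral => //.
  - move=> t; rewrite /= in_itv/= => /andP[t0 _].
    by rewrite mule_ge0 ?poweR_ge0// lee_fin invr_ge0 ltW.
  - move=> j _ t; rewrite /quart_itv/= !in_itv/= => /andP[t1 t2]; apply/andP; split.
      by apply: lt_trans t1; rewrite invr_gt0 exprn_gt0.
    by apply: (lt_le_trans t2); rewrite invf_le1 ?exprn_gt0// exprn_ege1// ler1n.
  move=> j t jn tj; rewrite /a mulrC EFinM; apply: lee_pmul.
  - by rewrite lee_fin powR_ge0.
  - by rewrite lee_fin exprn_ge0.
  - rewrite -poweR_EFin; apply: gt0_ler_poweR; first exact: ltW.
    + by rewrite in_itv/= leey andbT lee_fin mulr_ge0 ?powR_ge0.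
    + by rewrite in_itv/= leey andbT fun_profile_ge0.
    + apply: (le_trans _ (fun_profile_ge f alpha_le0 tj)).
      by rewrite EFinM; apply: lee_pmul; rewrite ?lee_fin ?powR_ge0// Hc.
  - move: tj; rewrite /quart_itv/= in_itv/= => /andP[t1 t2].
    have t0 : 0 < t by apply: lt_trans t1; rewrite invr_gt0 exprn_gt0.
    by rewrite lee_fin -[leLHS]invrK lef_pV2 ?posrE ?invr_gt0 ?exprn_gt0// ltW.
have -> : \sum_(i < n) a i * (3%:R / 4%:R * 4%:R^-i) =
    3%:R / 4%:R * 3%:R `^ (alpha * r) * \sum_(i < n) ((1 + i%:R) `^ alpha * c i) `^ r.
  rewrite mulr_sumr; apply: eq_bigr => i _; rewrite /a.
  have -> : (3%:R * (1 + i%:R)) `^ alpha * c i = 3%:R `^ alpha * ((1 + i%:R) `^ alpha * c i).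
    by rewrite mulrA -powRM.
  rewrite [X in _ * X * _]powRM ?powR_ge0 ?mulr_ge0 ?powR_ge0// -powRrM; set u := 3%:R `^ _; set v := (_ * c i) `^ r.
  have e0 : (4%:R ^+ i : R) != 0 by rewrite expf_neq0.
  by field.
set W := \sum_(i < n) _; rewrite mulNr powRN.
have : 0 < 3%:R `^ (alpha * r) :> R by rewrite powR_gt0.
set u := 3%:R `^ (alpha * r) => u0 H.
have -> : W = 4%:R / 3%:R * u^-1 * (3%:R / 4%:R * u * W) by field; rewrite gt_eqF.
by rewrite ler_wpM2l// mulr_ge0// invr_ge0 ltW.
Qed.

Lemma seq_quasinorm_le_fin (p : nat) :
  (fun_quasinorm r%:E alpha (fun_rearrangement f) < +oo)%E ->
  (seq_quasinorm r%:E alpha (seq_rearrangement (fourier_coef phi f)) <=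
   (finite_exponent_const * growth_factor p)%:E *
   fun_quasinorm r%:E alpha (fun_rearrangement f))%E.
Proof.
rewrite -[fun_quasinorm _ _ _]/((\int[mu]_(t in `]0%R, 1%R[)
  (fun_profile f alpha t `^ r * (t^-1)%:E)) `^ r^-1)%E.
set I := (\int[mu]_(t in _) _)%E => Ioo.
have I0 : (0 <= I)%E.
  apply: integral_ge0 => t; rewrite /= in_itv/= => /andP[t0 _].
  by rewrite mule_ge0 ?poweR_ge0// lee_fin invr_ge0 ltW.
have Ifin : I \is a fin_num.
  by rewrite ge0_fin_numE//; apply: lty_poweRy Ioo; rewrite invr_eq0 gt_eqF.
have IE : (fine I)%:E = I by exact: fineK.
have fI0 : 0 <= fine I by exact: fine_ge0.
have step (c : nat -> R) n := @profile_step_sum_le (fine I) c n.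
rewrite IE in step.
set V := 4%:R / 3%:R * 3%:R `^ (- alpha * r) * fine I.
have V0 : 0 <= V by rewrite !mulr_ge0 ?powR_ge0.
have tfin i : tail_energy f (4%:R^-i) \is a fin_num.
  rewrite ge0_fin_numE ?tail_energy_ge0// ltey; apply/eqP => too.
  have w0 : 0 < (1 + i%:R) `^ alpha :> R by rewrite powR_gt0// ltr_pwDl.
  (* If the tail energy were infinite, a spike of this height at i would be admissible; its term in
     the step sum is V + 1, above the bound V. *)
  pose x := (V + 1) `^ r^-1 / (1 + i%:R) `^ alpha.
  have wx : (1 + i%:R) `^ alpha * x = (V + 1) `^ r^-1 by rewrite /x mulrC divfK ?gt_eqF.
  have x0 : 0 <= x by rewrite divr_ge0 ?powR_ge0.
  have := step (fun j => if j == i then x else 0) i.+1 (lexx _).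
  have H1 j : 0 <= if j == i then x else 0 by case: ifP.
  have H2 j : (j < i.+1)%N ->
      ((if j == i then x else 0)%:E <= tail_energy f (4%:R^-j) `^ 2^-1)%E.
    by move=> _; case: eqP => [->|_]; [rewrite too poweRyr// leey|exact: poweR_ge0].
  move=> /(_ H1 H2); rewrite -/V big_ord_recr/= eqxx wx.
  rewrite -powRrM mulVf ?gt_eqF// powRr1 ?addr_ge0//; apply/negP; rewrite -ltNge.
  rewrite ltr_wpDl//; first by apply: sumr_ge0 => j _; exact: powR_ge0.
  by rewrite ltrDl.
pose b i := Num.sqrt (fine (tail_energy f (4%:R^-i))).
have b0 i : 0 <= b i by exact: sqrtr_ge0.
have bE i : (tail_energy f (4%:R^-i) = (b i ^+ 2)%:E)%E.
  by rewrite sqr_sqrtr ?fineK// fine_ge0// tail_energy_ge0.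
pose a i := (1 + i%:R) `^ alpha * b i.
have a0 i : 0 <= a i by rewrite mulr_ge0 ?powR_ge0.
have aV n : \sum_(0 <= i < n) a i `^ r <= V.
  rewrite big_mkord; apply: step => // i _.
  by rewrite bE poweR_EFin powR12_sqrt ?sqr_ge0// sqrtr_sqr ger0_norm.
have [Y [Y0 aY HY]] := tail_majorant p r_gt0 a0 aV.
have HT j m : (tail_energy f (4%:R^-(j + p + m)) <=
    (((1 + (j + p + m)%:R) `^ (- alpha) * (6%:R / 5%:R) ^+ m * Y j) ^+ 2)%:E)%E.
  rewrite bE lee_fin ler_sqr ?nnegrE ?mulr_ge0 ?powR_ge0 ?exprn_ge0//.
  rewrite -mulrA powRN ler_pdivlMl ?powR_gt0 ?ltr_pwDl//.
  exact: aY.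
have gc_gt0 := geometric_const_gt0.
set D := 290%:R * K * growth_factor p.
have D0 : 0 <= D by apply: mulr_ge0; [rewrite mulr_ge0// ltW|exact: growth_factor_ge0].
have F0 N : (0 <= seq_profile f phi alpha N)%E.
  by rewrite mule_ge0 ?poweR_ge0// lee_fin powR_ge0.
have FD j N : (4 ^ j <= N < 4 ^ j.+1)%N ->
    (seq_profile f phi alpha N `^ r <= (D `^ r * Y j `^ r)%:E)%E.
  move=> /andP[jN Nj]; rewrite -powRM// -poweR_EFin.
  apply: gt0_ler_poweR; first exact: ltW.
  - by rewrite in_itv/= leey andbT.
  - by rewrite in_itv/= leey andbT lee_fin mulr_ge0.
  apply: (seq_profile_block mf phi_orth phi_bound alpha_le0 K_gt0 K_growth (Y0 j) _ (HT j)).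
  by rewrite jN ltnW.
have total : (\sum_(1 <= i <oo) seq_profile f phi alpha i `^ r * (i%:R^-1)%:E <=
    (3%:R * (D `^ r * (V * geometric_const)))%:E)%E.
  apply: lime_le.
    by apply: is_cvg_nneseries => n _ _; rewrite mule_ge0 ?poweR_ge0// lee_fin invr_ge0.
  apply: nearW => n.
  (* Partial sums are enlarged to end at a block boundary. *)
  have n4 : (n <= 4 ^ n)%N by apply/ltnW/ltn_expl.
  apply: (@le_trans _ _ (\sum_(1 <= i < 4 ^ n) seq_profile f phi alpha i `^ r * (i%:R^-1)%:E)%E).
    apply: lee_sum_nneg_natr => // i _ _.
    by rewrite mule_ge0 ?poweR_ge0// lee_fin invr_ge0.
  apply: le_trans (dyadic_block_sum n _ _ FD) _.
  - by move=> j; rewrite mulr_ge0 ?powR_ge0.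
  - by move=> i; exact: poweR_ge0.
  by rewrite lee_fin ler_wpM2l// -mulr_sumr ler_wpM2l ?powR_ge0.
rewrite -[seq_quasinorm _ _ _]/((\sum_(1 <= i <oo) seq_profile f phi alpha i `^ r *
   (i%:R^-1)%:E) `^ r^-1)%E.
have T0 : (0 <= \sum_(1 <= i <oo) seq_profile f phi alpha i `^ r * (i%:R^-1)%:E)%E.
  by apply: nneseries_ge0 => n _ _; rewrite mule_ge0 ?poweR_ge0// lee_fin invr_ge0.
apply: (@le_trans _ _ ((3%:R * (D `^ r * (V * geometric_const)))%:E `^ r^-1)%E).
  apply: gt0_ler_poweR => //; first by rewrite invr_ge0 ltW.
  - by rewrite in_itv/= leey andbT.
  - rewrite in_itv/= leey andbT lee_fin; apply: mulr_ge0 => //.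
    by apply: mulr_ge0; [exact: powR_ge0|apply: mulr_ge0 => //; exact: ltW].
rewrite -IE !poweR_EFin -EFinM lee_fin le_eqVlt; apply/orP; left; apply/eqP.
have -> : 3%:R * (D `^ r * (V * geometric_const)) =
    D `^ r * (4%:R * 3%:R `^ (- alpha * r) * geometric_const) * fine I by rewrite /V; field.
rewrite powRM//; last by rewrite !mulr_ge0 ?powR_ge0// ltW.
rewrite powRM ?powR_ge0//; last by rewrite !mulr_ge0 ?powR_ge0// ltW.
rewrite -powRrM mulfV ?gt_eqF// powRr1//.
by rewrite /finite_exponent_const /D; set x := _ `^ r^-1; ring.
Qed.

End finite_exponent.
End quasinorm_bounds.

(** * Choice of the shift, and conclusion *)

(** The bounds share one [D] for all p, so p may depend on M: at p = 0 the growth factor is M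
    itself, and [dyadic_exponent] handles the other side of the minimum. *)
Lemma growth_factor_choice (R : realType) (alpha M D : R) (S T : \bar R) :
  alpha <= 0 -> 1 <= M -> 0 <= D -> (0 <= T)%E ->
  (forall p, (S <= (D * growth_factor alpha M p)%:E * T)%E) ->
  (S <= (2%:R `^ (- alpha) * D * Num.min M ((1 + ln M) `^ `|alpha|))%:E * T)%E.
Proof.
move=> a0 M1 D0 T0 HS.
have b0 : 0 <= - alpha by rewrite oppr_ge0.
have two : 1 <= 2%:R `^ (- alpha) :> R.
  by rewrite -[leLHS](powRr0 2%:R); apply: ler_powR => //; rewrite ler1n.
rewrite ler0_norm//.
suff [p Hp] : exists p, growth_factor alpha M p <=
    2%:R `^ (- alpha) * Num.min M ((1 + ln M) `^ (- alpha)).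
  apply: le_trans (HS p) _; apply: lee_wpmul2r => //.
  by rewrite lee_fin -mulrA [leRHS]mulrCA ler_wpM2l.
have [lt|le] := leP M ((1 + ln M) `^ (- alpha)).
  exists 0%N; rewrite /growth_factor expr0 divr1 max_r// addr0 powR1 mulr1.
  by rewrite ler_peMl// (le_trans ler01).
exact: dyadic_exponent.
Qed.

Theorem theorem1p1 (R : realType) (q : \bar R) (alpha : R)
    (q_gt0 : (0 < q)%E) (alpha_lt : (alpha%:E < - q^-1)%E) :
  exists C : R, 0 < C /\
    forall (k : index_kind) (phi : sys_index k -> R -> R[i]) (M : R) (f : R -> R[i]),
      orthonormal_system phi ->
      sup_norm phi = M%:E ->
      cmeasurable f ->
      (fun_quasinorm q alpha (fun_rearrangement f) < +oo)%E ->
      (seq_quasinorm q alpha (seq_rearrangement (fourier_coef phi f)) <=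
       (C * Num.min M ((1 + ln M) `^ `|alpha|))%:E *
       fun_quasinorm q alpha (fun_rearrangement f))%E.

Proof.
have alpha_lt0 : alpha < 0.
  rewrite -lte_fin; apply: (lt_le_trans alpha_lt).
  rewrite leeNl oppe0; move: q_gt0; clear alpha_lt; case: q => [r| |]//.
  rewrite lte_fin => r0.
  by rewrite inver gt_eqF// lee_fin invr_ge0 ltW.
have alpha_le0 := ltW alpha_lt0.
have g1 : 1 < 5%:R / 4%:R :> R by lra.
have [K K0 HK] := powR_le_geometric (- alpha) g1.
have two0 : 0 < 2%:R `^ (- alpha) :> R by rewrite powR_gt0.
move: q_gt0; clear alpha_lt; case: q => [r| |]//.
  rewrite lte_fin => r0.
  have D0 : 0 < finite_exponent_const alpha K r.
    rewrite /finite_exponent_const !mulr_gt0// powR_gt0// !mulr_gt0 ?powR_gt0//.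
    exact: geometric_const_gt0.
  exists (2%:R `^ (- alpha) * finite_exponent_const alpha K r).
  split; first exact: mulr_gt0.
  move=> k phi M f orth bound mf fin.
  apply: growth_factor_choice => //.
  - exact: sup_norm_ge1 orth bound.
  - exact: ltW.
  - exact: poweR_ge0.
  - by move=> p; apply: seq_quasinorm_le_fin.
move=> _; have D0 : 0 < 290%:R * K * 3%:R `^ (- alpha) by rewrite !mulr_gt0 ?powR_gt0.
exists (2%:R `^ (- alpha) * (290%:R * K * 3%:R `^ (- alpha))).
split; first exact: mulr_gt0.
move=> k phi M f orth bound mf fin.
apply: growth_factor_choice => //.
- exact: sup_norm_ge1 orth bound.
- exact: ltW.
(* The supremum is nonnegative because it dominates a value of the profile, here at t = 1/2. *)
- apply: (@le_trans _ _ (fun_profile f alpha 2%:R^-1)); first exact: fun_profile_ge0.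
  apply: ereal_sup_ubound; exists (2%:R^-1) => //=.
  by rewrite in_itv/=; apply/andP; split; lra.
- by move=> p; apply: seq_quasinorm_le_oo.
Qed.
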